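(* Let $G=(V,E)$ be a finite undirected graph (parallel edges allowed), let $k$ and $\ell$ be integers with $1 \leq \ell \leq k-1$, and let $x \in P^f_{con}(G,k)$. If $\ell|V|$ is even, or if $x(E) \geq \frac{k|V|}{2}+\frac{k}{2\ell}$, then $\frac{\ell}{k}x \in P_{cov}(G,\ell)$. Otherwise, $\frac{\ell|V|+1}{2x(E)}\cdot x \in P_{cov}(G,\ell)$, and hence also $\left(\frac{\ell}{k}+\frac{1}{k|V|}\right)\cdot x \in P_{cov}(G,\ell)$.
   Context: For $x \in \mathbb{R}^E$ and $F \subseteq E$, $x(F)=\sum_{e\in F}x(e)$. For $S \subseteq V$, $\delta(S)$ is the set of edges of $E$ with exactly one endnode in $S$. The fractional $k$-edge-connectivity polytope $P^f_{con}(G,k)$ is the set of $x \in \mathbb{R}^E$ with $x(\delta(S)) \geq k$ for all $\emptyset \neq S \subsetneq V$ and $0 \leq x_e \leq 1$ for all $e\in E$. An edge set $I \subseteq E$ is an $\ell$-edge-cover if every node of the graph $(V,I)$ has degree at least $\ell$. The integral $\ell$-edge-cover polytope $P_{cov}(G,\ell)$ is the convex hull of the characteristic vectors (in $\{0,1\}^E$) of the $\ell$-edge-covers of $G$.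
   Formalization: The graph is taken loopless and with |V| ≠ 1: for a single node with no edges the cut constraints are vacuous, so the connectivity polytope is non-empty while no ℓ-edge-cover exists, and the claim fails. *)

(* Defs.v *)
From mathcomp Require Import all_boot all_order all_algebra.

Set Implicit Arguments.
Unset Strict Implicit.
Unset Printing Implicit Defensive.

Import Order.TTheory GRing.Theory Num.Theory.
Local Open Scope ring_scope.

(* Edges form a type of their own, so that distinct edges may have the same
   pair of endnodes; loops are excluded. *)
Record multigraph (V E : finType) := Multigraph {
  ends : E -> {set V};
  ends_card : forall e, #|ends e| = 2%N
}.

Section Graph.
Variables (V E : finType) (G : multigraph V E).

Definition cut (S : {set V}) : {set E} := [set e | #|ends G e :&: S| == 1%N].

Definition degree (I : {set E}) (v : V) : nat := #|[set e in I | v \in ends G e]|.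

Definition edge_cover (l : nat) (I : {set E}) : Prop :=
  forall v : V, (l <= degree I v)%N.

End Graph.

(* Vectors of R^E are finite functions with values in the regular module R^o,
   which makes {ffun E -> R^o} a left module over R. *)
Definition edge_sum (R : pzRingType) (E : finType) (x : {ffun E -> R^o})
  (F : {set E}) : R := \sum_(e in F) x e.

Definition char_vec (R : pzRingType) (E : finType) (I : {set E}) :
  {ffun E -> R^o} := [ffun e => (e \in I)%:R].

Definition convex_hull (R : numDomainType) (W : lmodType R) (A : W -> Prop)
  (y : W) : Prop :=
  exists (n : nat) (a : 'I_n -> R) (p : 'I_n -> W),
    [/\ forall i, A (p i), forall i, 0 <= a i, \sum_i a i = 1
      & y = \sum_i a i *: p i].

Section Polytopes.
Variables (R : realFieldType) (V E : finType) (G : multigraph V E).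

Definition con_polytope (k : nat) (x : {ffun E -> R^o}) : Prop :=
  (forall S : {set V}, S != set0 -> S \proper [set: V] ->
     k%:R <= edge_sum x (cut G S))
  /\ (forall e : E, 0 <= x e <= 1).

Definition cov_polytope (l : nat) : {ffun E -> R^o} -> Prop :=
  convex_hull (fun y : {ffun E -> R^o} =>
    exists2 I : {set E}, edge_cover G l I & y = char_vec R I).

End Polytopes.

(* Main.v *)
Require Import Defs.
From mathcomp Require Import all_boot all_order all_algebra.
From mathcomp Require Import ring lra zify.
Set Implicit Arguments.
Unset Strict Implicit.
Unset Printing Implicit Defensive.
Import Order.TTheory GRing.Theory Num.Theory.
Local Open Scope ring_scope.

(* Each of the scaled vectors y = c x satisfies the inequalities
     sum_{u in S} (y(delta(u)) - l) + y(delta(S) \ F) + |F| - y(F) >= 1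
   for F included in delta(S) with l|S| + |F| odd: for S = V this is the
   assumption on parity or on x(E), and for S <> V it follows from
   y(delta(S)) >= c k >= l and c <= 1.  These inequalities put y in the cover
   polytope.  Indeed, I is an l-edge-cover when its complement has degree at
   most deg(v) - l at v, and such sets are read off the matchings of a graph
   with two adjacent darts for each edge and deg(v) - l slots for each node v;
   y becomes a weighting of this graph, for which the odd cut inequalities are
   exactly the above ones.  Matchings become perfect matchings in two copies of
   the graph with twin nodes joined.  Edmonds' theorem on perfect matchings is
   proved by induction: a nontrivial tight odd cut is contracted on either side
   and the two distributions on matchings are coupled along the cut; without
   such a cut, a non-integral point can be moved both ways along a direction
   that preserves all degrees, until an edge vanishes or an odd cut becomes
   tight. *)

(** * Perfect matchings *)

Section PerfectMatchings.
Variables (R : realFieldType) (V : finType).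
Implicit Types (x d : V -> V -> R) (A S T : {set V}) (s : {ffun V -> V}).

Definition cut_weight x A S : R := \sum_(u in S) \sum_(v in A :\: S) x u v.

(** Edmonds' system for the perfect matchings of the complete graph on [A]. The odd cut condition
    includes [S = A], which forces [#|A|] to be even. *)
Definition feasible A x : Prop :=
  [/\ forall u v, x u v = x v u, forall u, x u u = 0, forall u v, 0 <= x u v,
      forall u, u \in A -> cut_weight x A [set u] = 1
    & forall S, S \subset A -> odd #|S| -> 1 <= cut_weight x A S].

(* The values of [s] outside [A] are irrelevant. *)
Definition perfect_matching A (s : V -> V) : bool :=
  [forall u in A, [&& s u \in A, s u != u & s (s u) == u]].

(** Membership in the hull is phrased as a probability distribution with marginals [x], the form in
    which two distributions can be coupled. *)
Definition matching_hull A x : Prop :=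
  exists mu : {ffun V -> V} -> R,
    [/\ forall s, 0 <= mu s, \sum_s mu s = 1,
        forall s, mu s != 0 -> perfect_matching A s
      & forall u v, u \in A -> v \in A ->
          \sum_(s : {ffun V -> V} | s u == v) mu s = x u v].

Lemma perfect_matchingP A (s : V -> V) u : perfect_matching A s -> u \in A ->
  [/\ s u \in A, s u != u & s (s u) = u].
Proof. by move=> /forall_inP h /h /and3P[? ? /eqP]. Qed.

Lemma matching_hull_family (I : finType) (w : I -> R) (g : I -> {ffun V -> V})
    A x :
  (forall i, 0 <= w i) -> \sum_i w i = 1 ->
  (forall i, w i != 0 -> perfect_matching A (g i)) ->
  (forall u v, u \in A -> v \in A -> \sum_(i | g i u == v) w i = x u v) ->
  matching_hull A x.
Proof.
move=> w0 w1 wg wx; exists (fun s => \sum_(i | g i == s) w i); split.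
- by move=> s; apply: sumr_ge0.
- by rewrite -w1 [RHS](partition_big g xpredT).
- move=> s; apply: contraR => hs; apply/eqP; rewrite big1 // => i /eqP gi.
  by apply/eqP; apply: contraR hs => /wg; rewrite gi.
- move=> u v uA vA; rewrite -wx //.
  rewrite [RHS](partition_big g (fun s => s u == v)) //=.
  apply: eq_bigr => s su; apply: eq_bigl => i.
  by case: eqP => [->|]; rewrite ?su ?andbF.
Qed.

Lemma matching_hull_ext A x x' :
  {in A &, forall u v, x u v = x' u v} ->
  matching_hull A x -> matching_hull A x'.
Proof.
move=> xx' [mu [h1 h2 h3 h4]]; exists mu; split=> // u v uA vA.
by rewrite -xx' // h4.
Qed.

Lemma matching_hull_convex A x x' (t : R) : 0 <= t <= 1 ->
  matching_hull A x -> matching_hull A x' ->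
  matching_hull A (fun u v => t * x u v + (1 - t) * x' u v).
Proof.
move=> /andP[t0 t1] [mu [h1 h2 h3 h4]] [nu [k1 k2 k3 k4]].
have t1' : 0 <= 1 - t by rewrite subr_ge0.
exists (fun s => t * mu s + (1 - t) * nu s); split.
- by move=> s; rewrite addr_ge0 // mulr_ge0.
- by rewrite big_split -!mulr_sumr h2 k2 /= !mulr1 addrC subrK.
- move=> s; apply: contraR => hs.
  have [/eqP -> | /h3] := boolP (mu s == 0); last by rewrite (negPf hs).
  have [/eqP -> | /k3] := boolP (nu s == 0); last by rewrite (negPf hs).
  by rewrite !mulr0 addr0.
- by move=> u v uA vA; rewrite big_split -!mulr_sumr h4 // k4.
Qed.

Lemma cut_weight1 A x u : x u u = 0 ->
  cut_weight x A [set u] = \sum_(v in A) x u v.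
Proof.
move=> xu; rewrite /cut_weight big_set1.
have [uA|uA] := boolP (u \in A).
  rewrite [RHS](bigD1 u) //= xu add0r; apply: eq_bigl => v.
  by rewrite !inE andbC.
by apply: eq_bigl => v; rewrite !inE; case: eqP => // ->; rewrite (negPf uA).
Qed.

Lemma feasible_row A x u : feasible A x -> u \in A -> \sum_(v in A) x u v = 1.
Proof. by case=> _ x0 _ xr _ uA; rewrite -cut_weight1 ?xr. Qed.

Lemma cut_weightC A x S : (forall u v, x u v = x v u) -> S \subset A ->
  cut_weight x A (A :\: S) = cut_weight x A S.
Proof.
move=> xC SA; rewrite /cut_weight setDDr setDv set0U (setIidPr SA) exchange_big.
by apply: eq_bigr => u _; apply: eq_bigr => v _.
Qed.

Lemma feasible_even A x : feasible A x -> ~~ odd #|A|.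
Proof.
case=> _ _ _ _ h; apply/negP => /(h A (subxx _)).
by rewrite /cut_weight setDv big1 ?ler10 // => u _; rewrite big_set0.
Qed.

Lemma feasible_setD_odd A x S : feasible A x -> S \subset A -> odd #|S| ->
  odd #|A :\: S|.
Proof.
move=> /feasible_even + SA.
by rewrite cardsDS // oddB ?subset_leq_card // => /negPf -> ->.
Qed.

(** Each row sums to 1 and so contains exactly one 1: [x] is itself a perfect matching, and a point
    mass suffices. *)
Lemma feasible_integral A x : feasible A x ->
  {in A &, forall u v, x u v = 0 \/ x u v = 1} -> matching_hull A x.
Proof.
move=> fx xi; have [xC xd x0 _ _] := fx.
have ex u : u \in A -> exists v, (v \in A) && (x u v == 1).
  move=> uA; apply/existsP; apply: contraT; rewrite negb_exists => /forallP h.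
  have := feasible_row fx uA; rewrite big1 => [/esym/eqP|v vA].
    by rewrite oner_eq0.
  by case: (xi u v uA vA) => // xuv; have := h v; rewrite vA xuv eqxx.
have un u v w : u \in A -> v \in A -> w \in A -> x u v = 1 -> x u w = 1 -> v = w.
  move=> uA vA wA uv uw; apply/eqP; apply: contraT => vw.
  have := feasible_row fx uA; rewrite (bigD1 v) //= (bigD1 w) /=; last first.
    by rewrite wA eq_sym.
  rewrite uv uw => h.
  have : 0 <= \sum_(i in A | (i != v) && (i != w)) x u i by exact: sumr_ge0.
  by under eq_bigl do rewrite andbA; move: h => /eqP; lra.
pose f := [ffun u => odflt u [pick v in A | x u v == 1]].
have fP u : u \in A -> f u \in A /\ x u (f u) = 1.
  move=> uA; rewrite ffunE; case: pickP => [v /andP[? /eqP]|] //= h.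
  by have [v] := ex u uA; rewrite h.
apply: (@matching_hull_family unit (fun=> 1) (fun=> f)) => //.
- by rewrite big_const card_unit /= addr0.
- move=> _ _; apply/forall_inP => u uA; have [fA xf] := fP u uA.
  have [ffA xff] := fP _ fA.
  rewrite fA /=; apply/andP; split.
    apply/eqP => fu; move: xf; rewrite fu xd => /esym/eqP.
    by rewrite oner_eq0.
  by apply/eqP; apply: (un (f u)) => //; rewrite xC.
- move=> u v uA vA; have [fA xf] := fP u uA.
  case: eqP => [<-|fv]; rewrite ?xf.
    by rewrite big_const card_unit /= addr0.
  rewrite big_pred0 //; case: (xi u v uA vA) => // xv.
  by case: fv; exact: un xf xv.
Qed.

End PerfectMatchings.

(** * Contraction of a tight odd cut *)

Section Coupling.
Variables (R : realFieldType) (I J X Y : finType).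
Variables (mu : I -> R) (nu : J -> R) (f : I -> X) (g : J -> Y).
Variables (T : {set X}) (S : {set Y}) (m : X -> Y -> R).
Hypothesis mu0 : forall i, 0 <= mu i.
Hypothesis m0 : forall u v, 0 <= m u v.
Hypothesis mu_T : forall i, mu i != 0 -> f i \in T.
Hypothesis nu_S : forall j, nu j != 0 -> g j \in S.
Hypothesis mu_m : forall u, u \in T ->
  \sum_(i | f i == u) mu i = \sum_(v in S) m u v.
Hypothesis nu_m : forall v, v \in S ->
  \sum_(j | g j == v) nu j = \sum_(u in T) m u v.

(** With [m] read as the joint law of [(f i, g j)], the indices [i] and [j] are drawn independently
    given these two values. Division by zero yields 0, which is the right value for pairs of
    probability zero. *)
Definition coupling_weight i j :=
  mu i * nu j * (m (f i) (g j) /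
   ((\sum_(v in S) m (f i) v) * (\sum_(u in T) m u (g j)))).

Lemma coupling_marginal i : \sum_j coupling_weight i j = mu i.
Proof.
have [mi0|mi] := eqVneq (mu i) 0.
  by rewrite big1 ?mi0 // => j _; rewrite /coupling_weight mi0 !mul0r.
have fT := mu_T mi; set a := \sum_(v in S) m (f i) v.
have a0 : a != 0.
  rewrite /a -mu_m // gt_eqF // (bigD1 i) //=.
  by rewrite ltr_pwDl ?sumr_ge0 // lt_def mi mu0.
rewrite (partition_big g xpredT) //= (bigID (mem S)) /= addrC big1 => [|v vS].
  rewrite add0r; transitivity (\sum_(v in S) mu i * (m (f i) v / a)).
    apply: eq_bigr => v vS.
    pose c := mu i * (m (f i) v / (a * \sum_(u in T) m u v)).
    transitivity (\sum_(j | g j == v) nu j * c).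
      apply: eq_bigr => j /eqP gj; rewrite /coupling_weight gj -/a /c; ring.
    rewrite -mulr_suml nu_m // /c.
    (* If the sum vanishes, then so does [m u v] by nonnegativity. *)
    have [b0|b0] := eqVneq (\sum_(u in T) m u v) 0; last by field; rewrite a0.
    have /psumr_eq0P m0v : \sum_(u in T) m u v = 0 by [].
    by rewrite b0 m0v // !mul0r mulr0.
  by rewrite -mulr_sumr -mulr_suml divff // mulr1.
rewrite big1 // => j /eqP gj; have [nj|/nu_S] := eqVneq (nu j) 0.
  by rewrite /coupling_weight nj mulr0 mul0r.
by rewrite gj (negPf vS).
Qed.

Lemma coupling_joint u v : u \in T -> v \in S ->
  \sum_(i | f i == u) \sum_(j | g j == v) coupling_weight i j = m u v.
Proof.
move=> uT vS; set a := \sum_(v in S) m u v; set b := \sum_(u in T) m u v.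
pose c := m u v / (a * b).
transitivity (\sum_(i | f i == u) \sum_(j | g j == v) (mu i * c) * nu j).
  apply: eq_bigr => i /eqP fi; apply: eq_bigr => j /eqP gj.
  rewrite /coupling_weight fi gj -/a -/b /c; ring.
under eq_bigr do rewrite -mulr_sumr nu_m //.
rewrite -mulr_suml -mulr_suml mu_m // -/a -/b /c.
have [a0|a0] := eqVneq a 0.
  by have /psumr_eq0P h := a0; rewrite h // !(mul0r, mulr0).
have [b0|b0] := eqVneq b 0; last by field; rewrite b0.
by have /psumr_eq0P h := b0; rewrite h // !(mul0r, mulr0).
Qed.

End Coupling.

Lemma coupling_weightC (R : realFieldType) (I J X Y : finType)
    (mu : I -> R) (nu : J -> R) (f : I -> X) (g : J -> Y)
    (T : {set X}) (S : {set Y}) (m : X -> Y -> R) i j :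
  coupling_weight mu nu f g T S m i j =
  coupling_weight nu mu g f S T (fun v u => m u v) j i.
Proof. by rewrite /coupling_weight (mulrC (nu j)) [X in _ / X]mulrC. Qed.

Lemma coupling_exists (R : realFieldType) (I J X Y : finType)
    (mu : I -> R) (nu : J -> R) (f : I -> X) (g : J -> Y)
    (T : {set X}) (S : {set Y}) (m : X -> Y -> R) :
  (forall i, 0 <= mu i) -> (forall j, 0 <= nu j) -> (forall u v, 0 <= m u v) ->
  (forall i, mu i != 0 -> f i \in T) -> (forall j, nu j != 0 -> g j \in S) ->
  (forall u, u \in T -> \sum_(i | f i == u) mu i = \sum_(v in S) m u v) ->
  (forall v, v \in S -> \sum_(j | g j == v) nu j = \sum_(u in T) m u v) ->
  exists w : I -> J -> R,
    [/\ forall i j, 0 <= w i j,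
        forall i, \sum_j w i j = mu i, forall j, \sum_i w i j = nu j,
        {in T & S, forall u v,
           \sum_(i | f i == u) \sum_(j | g j == v) w i j = m u v}
      & forall i j, w i j != 0 -> (mu i != 0) && (nu j != 0)].
Proof.
move=> mu0 nu0 m0 muT nuS mum num.
exists (coupling_weight mu nu f g T S m); split.
- move=> i j; rewrite /coupling_weight mulr_ge0 ?divr_ge0 ?mulr_ge0 //.
    exact: sumr_ge0.
  exact: sumr_ge0.
- by move=> i; apply: coupling_marginal.
- move=> j; under eq_bigr do rewrite coupling_weightC.
  by apply: coupling_marginal.
- by move=> u v uT vS; apply: coupling_joint.
- move=> i j; rewrite /coupling_weight; apply: contraR; rewrite negb_and !negbK.
  by case/orP => /eqP ->; rewrite ?mulr0 !mul0r.
Qed.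

(** * Contracting one side of a cut to a node *)

Section Contraction.
Variables (R : realFieldType) (V : finType).
Implicit Types (x : V -> V -> R) (A S T : {set V}).

(** Collapsing [S] onto a representative [r] in [S] keeps the contracted graph inside the type
    [V]. *)
Definition contract_map S (r u : V) := if u \in S then r else u.

(** Parallel edges add up; the diagonal is reset to 0 because edges inside [S] would become
    loops. *)
Definition contract A S r x a b : R :=
  if a == b then 0 else
  \sum_(u in A | contract_map S r u == a)
    \sum_(v in A | contract_map S r v == b) x u v.

Lemma cut_weight_contract A S r x S' : S \subset A -> r \in S ->
  S' \subset r |: (A :\: S) ->
  cut_weight (contract A S r x) (r |: (A :\: S)) S' =
  cut_weight x A [set u in A | contract_map S r u \in S'].
Proof.
move=> SA rS S'A; rewrite /cut_weight.
rewrite [RHS](partition_big (contract_map S r) (mem S')) /=; last first.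
  by move=> u; rewrite inE => /andP[].
apply: eq_bigr => a aS'.
transitivity (\sum_(b in (r |: A :\: S) :\: S')
  \sum_(u in A | contract_map S r u == a)
    \sum_(v in A | contract_map S r v == b) x u v).
  apply: eq_bigr => b; rewrite inE => /andP[bS' _].
  by rewrite /contract; case: eqP bS' => // <-; rewrite aS'.
rewrite exchange_big /=; apply: eq_big => [u|u _].
  by rewrite inE; case: eqP => [->|]; rewrite ?aS' ?andbT ?andbF.
rewrite [RHS](partition_big (contract_map S r)
   (mem ((r |: A :\: S) :\: S'))) /=; last first.
  move=> v; rewrite !inE => /andP[+ vA]; rewrite vA /= => -> /=.
  by rewrite /contract_map; case: ifP => vS; rewrite ?eqxx ?vS ?vA ?orbT.
apply: eq_bigr => b; rewrite !inE => /andP[bS' _]; apply: eq_bigl => v.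
rewrite !inE; case: eqP => [->|]; last by rewrite !andbF.
by rewrite (negPf bS') !andbT andbF.
Qed.

Lemma contract_id A S r x a b : r \in S -> x a a = 0 ->
  a \in A :\: S -> b \in A :\: S -> contract A S r x a b = x a b.
Proof.
move=> rS xa; rewrite !inE => /andP[aS aA] /andP[bS bA]; rewrite /contract.
have E c u : c \notin S -> c \in A ->
    (u \in A) && (contract_map S r u == c) = (u == c).
  move=> cS cA; rewrite /contract_map; case: ifP => uS.
    have /negPf -> : r != c by apply: contraNneq cS => <-.
    by rewrite andbF; apply/esym/negbTE; apply: contraNneq cS => <-.
  by case: eqP => [->|]; rewrite ?cA ?andbF.
case: eqP => [<- //|_]; under eq_bigl do rewrite E //.
by rewrite big_pred1_eq; under eq_bigl do rewrite E //; rewrite big_pred1_eq.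
Qed.

Lemma contract_rep A S r x b : r \in S -> S \subset A ->
  b \in A :\: S -> contract A S r x r b = \sum_(s in S) x s b.
Proof.
move=> rS SA; rewrite !inE => /andP[bS bA]; rewrite /contract.
have /negPf -> : r != b by apply: contraNneq bS => <-.
apply: eq_big => [u|u _].
  rewrite /contract_map; case: ifP => uS; first by rewrite eqxx (subsetP SA).
  by apply/negbTE; apply: contraFN uS => /andP[_ /eqP ->].
rewrite (eq_bigl (pred1 b)) ?big_pred1_eq // => v /=.
rewrite /contract_map; case: ifP => vS.
  have /negPf -> : r != b by apply: contraNneq bS => <-.
  by rewrite andbF; apply/esym/negbTE; apply: contraNneq bS => <-.
by case: eqP => [->|]; rewrite ?bA ?andbF.
Qed.

(** Every cut of the contraction is the cut of its preimage in [A]. Parity survives because the odd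
    set [S] replaces the single node [r], and the degree of [r] is the weight of the tight cut. *)
Lemma feasible_contract A S r x : feasible A x -> S \subset A -> r \in S ->
  odd #|S| -> cut_weight x A S = 1 ->
  feasible (r |: (A :\: S)) (contract A S r x).
Proof.
move=> [xC xd x0 xr xo] SA rS oS S1; split.
- move=> u v; rewrite /contract eq_sym; case: eqP => // _.
  by rewrite exchange_big; apply: eq_bigr => i _; apply: eq_bigr => j _.
- by move=> u; rewrite /contract eqxx.
- move=> u v; rewrite /contract; case: eqP => // _.
  by apply: sumr_ge0 => i _; apply: sumr_ge0.
- move=> u uA; rewrite cut_weight_contract //; last by rewrite sub1set.
  have [->|ur] := eqVneq u r.
    rewrite -[RHS]S1; congr (cut_weight x A _); apply/setP => v; rewrite !inE.
    rewrite /contract_map; case: ifP => vS; first by rewrite eqxx (subsetP SA).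
    by apply/negbTE; apply: contraFN vS => /andP[_ /eqP ->].
  have /andP[uS uA'] : (u \notin S) && (u \in A).
    by move: uA; rewrite !inE (negPf ur).
  rewrite -[RHS](xr u uA'); congr (cut_weight x A _); apply/setP => v.
  rewrite !inE /contract_map; case: ifP => vS.
    rewrite eq_sym (negPf ur) andbF; apply/esym/negbTE.
    by apply: contraNneq uS => <-.
  by case: eqP => [->|]; rewrite ?uA' ?andbF.
- move=> S' S'A oS'; rewrite cut_weight_contract //; apply: xo.
    by apply/subsetP => u; rewrite inE => /andP[].
  have [rS'|rS'] := boolP (r \in S').
    have -> : [set u in A | contract_map S r u \in S'] = S :|: (S' :\ r).
      apply/setP => u; rewrite !inE /contract_map; case: ifP => uS /=.
        by rewrite rS' (subsetP SA).
      have [ur|ur] := eqVneq u r; first by move: uS; rewrite ur rS.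
      apply: andb_idl => uS'; move: (subsetP S'A u uS').
      by rewrite !inE (negPf ur) uS.
    rewrite cardsU.
    have -> : S :&: (S' :\ r) = set0.
      apply/setP => u; rewrite !inE; apply/negbTE/negP => /and3P[uS ur uS'].
      by move: (subsetP S'A u uS'); rewrite !inE (negPf ur) uS.
    rewrite cards0 subn0 oddD oS.
    by move: oS'; rewrite (cardsD1 r) rS' /=; case: odd.
  suff -> : [set u in A | contract_map S r u \in S'] = S' by [].
  apply/setP => u; rewrite !inE /contract_map; case: ifP => uS.
    rewrite (negPf rS') andbF; apply/esym/negbTE/negP => uS'.
    move: (subsetP S'A u uS'); rewrite !inE uS orbF => /eqP ur.
    by move: rS'; rewrite -ur uS'.
  apply: andb_idl => uS'; move: (subsetP S'A u uS').
  by rewrite !inE uS /= => /orP[/eqP ur|//]; move: uS; rewrite ur rS.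
Qed.

End Contraction.

(** * Gluing matchings of the two contractions *)

Section Gluing.
Variables (R : realFieldType) (V : finType).
Implicit Types (x : V -> V -> R) (A S T : {set V}).

Lemma perfect_matching_rep T (r : V) (s : V -> V) : r \notin T ->
  perfect_matching (r |: T) s ->
  [/\ s r \in T, s (s r) = r
    & forall u, u \in T -> u != s r -> [/\ s u \in T, s u != s r & s (s u) = u]].
Proof.
move=> rT sp; have [h1 h2 h3] := perfect_matchingP sp (setU11 r T).
have sT : s r \in T by move: h1; rewrite !inE (negPf h2).
split=> // u uT us; have [k1 k2 k3] := perfect_matchingP sp (setU1r r uT).
have ur : u != r by apply: contraNneq rT => <-.
split=> //.
  by move: k1; rewrite !inE => /orP[/eqP sur|//]; move: us; rewrite -sur k3 eqxx.
by apply: contraNneq ur => sus; rewrite -k3 sus h3.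
Qed.

(** The edge of [s1] at the contracted node [r] and the edge of [s2] at [r'] are merged into one
    edge across the cut, from [s2 r'] to [s1 r]. *)
Definition glue S (r r' : V) (s1 s2 : V -> V) : {ffun V -> V} :=
  [ffun u => if u \in S then (if u == s2 r' then s1 r else s2 u)
             else (if u == s1 r then s2 r' else s1 u)].

Lemma perfect_matching_glue A S r r' s1 s2 : S \subset A ->
  r \in S -> r' \in A :\: S ->
  perfect_matching (r |: (A :\: S)) s1 -> perfect_matching (r' |: S) s2 ->
  perfect_matching A (glue S r r' s1 s2).
Proof.
move=> SA rS; rewrite inE => /andP[r'S r'A] p1 p2.
have rT : r \notin A :\: S by rewrite inE rS.
have [/setDP[vA vS] v2 hT] := perfect_matching_rep rT p1.
have [sS s3 hS] := perfect_matching_rep r'S p2.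
apply/forall_inP => u uA; rewrite /glue !ffunE.
have [uS|uS] := ifP.
  have [us|us] := eqVneq u (s2 r').
    rewrite vA (negPf vS) eqxx us eqxx andbT /=.
    by apply: contraNneq vS => ->.
  have [k1 k2 k3] := hS u uS us; rewrite k1 (subsetP SA) // (negPf k2) k3 eqxx.
  rewrite andbT /=; have [_ ->] // := perfect_matchingP p2 (setU1r r' uS).
have uT : u \in A :\: S by rewrite inE uS uA.
have [us|us] := eqVneq u (s1 r).
  rewrite sS (subsetP SA) // eqxx us eqxx andbT /=.
  by apply: contraNneq vS => <-.
have [k1 k2 k3] := hT u uT us; move: (k1) => /setDP[kA /negPf ->].
rewrite kA (negPf k2) k3 eqxx andbT /=.
by have [_ ->] // := perfect_matchingP p1 (setU1r r uT).
Qed.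

(** The two matchings are drawn jointly so that their merged edge has law [x] across the cut.
    Marginals inside a side then come from one matching, and those across the cut from the
    coupling. *)
Lemma matching_hull_glue A S r r' x x1 x2 :
  feasible A x -> S \subset A -> r \in S -> r' \in A :\: S ->
  {in A :\: S &, forall a b, x1 a b = x a b} ->
  {in A :\: S, forall b, x1 r b = \sum_(s in S) x s b} ->
  {in S &, forall a b, x2 a b = x a b} ->
  {in S, forall b, x2 r' b = \sum_(s in A :\: S) x s b} ->
  matching_hull (r |: (A :\: S)) x1 -> matching_hull (r' |: S) x2 ->
  matching_hull A x.
Proof.
move=> [xC xd x0 xr xo] SA rS r'T; set T := A :\: S => x1T x1r x2S x2r.
move=> [mu [m1 m2 m3 m4]] [nu [n1 n2 n3 n4]].
have rT : r \notin T by rewrite inE rS.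
have r'S : r' \notin S by case/setDP: r'T.
have TA : T \subset A by apply: subsetDl.
have TS u : u \in T -> u \in S = false by rewrite inE => /andP[/negPf].
(* By [x1r] and [x2r], the laws of [s r] under [mu] and of [s r'] under [nu] are the marginals of
   [x] on [T] and [S]. *)
have [w [w1 w2 w3 w4 w5]] := @coupling_exists R _ _ _ _ mu nu
  (fun s : {ffun V -> V} => s r) (fun s : {ffun V -> V} => s r') T S x m1 n1 x0
  (fun s sn => let: And3 h _ _ := perfect_matching_rep rT (m3 s sn) in h)
  (fun s sn => let: And3 h _ _ := perfect_matching_rep r'S (n3 s sn) in h)
  (fun u uT => etrans (m4 r u (setU11 r T) (setU1r r uT))
      (etrans (x1r u uT) (eq_bigr _ (fun s _ => xC s u))))
  (fun v vS => etrans (n4 r' v (setU11 r' S) (setU1r r' vS)) (x2r v vS)).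
have wP s1 s2 : w s1 s2 != 0 ->
    perfect_matching (r |: T) s1 /\ perfect_matching (r' |: S) s2.
  by move=> /w5/andP[/m3 ? /n3].
have crossed u v : u \in S -> v \in T ->
    \sum_(p : {ffun V -> V} * {ffun V -> V} | glue S r r' p.1 p.2 u == v)
       w p.1 p.2 = x u v.
  move=> uS vT; rewrite xC -w4 //.
  rewrite (pair_big (fun s : {ffun V -> V} => s r == v)
    (fun s : {ffun V -> V} => s r' == u)) /=.
  rewrite [LHS]big_mkcond [RHS]big_mkcond; apply: eq_bigr => -[s1 s2] _ /=.
  have [->|/wP[p1 p2]] := eqVneq (w s1 s2) 0; first by rewrite !if_same.
  congr (if _ then _ else _); rewrite /glue ffunE uS eq_sym [s2 r' == u]eq_sym.
  have [us|us] := eqVneq u (s2 r'); first by rewrite andbT eq_sym.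
  rewrite andbF; apply/negbTE/eqP => vs.
  have [_ _ /(_ u uS us)[]] := perfect_matching_rep r'S p2.
  by rewrite -vs (TS v vT).
apply: (@matching_hull_family _ _ _ (fun p => w p.1 p.2)
  (fun p => glue S r r' p.1 p.2)).
- by move=> p.
- by rewrite -(pair_bigA _ w) /= -m2; apply: eq_bigr.
- by move=> p /wP[]; apply: perfect_matching_glue.
- move=> u v uA vA.
  have [uS|uS] := boolP (u \in S); have [vS|vS] := boolP (v \in S).
  + rewrite -x2S // -n4 ?setU1r //.
    transitivity (\sum_(s2 : {ffun V -> V} | s2 u == v) \sum_s1 w s1 s2).
      rewrite exchange_big /= (pair_big xpredT (fun s : {ffun V -> V} => s u == v)).
      rewrite [LHS]big_mkcond [RHS]big_mkcond; apply: eq_bigr => -[s1 s2] _ /=.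
      have [->|/wP[p1 p2]] := eqVneq (w s1 s2) 0; first by rewrite !if_same.
      congr (if _ then _ else _); rewrite /glue ffunE uS.
      (* At the crossing node both tests fail: [glue] sends [u] into [T], and [s2] sends it to [r'],
         outside [S]. *)
      have [us|//] := eqVneq u (s2 r').
      have [_ + _] := perfect_matching_rep r'S p2; rewrite -us => ->.
      have [s1T _ _] := perfect_matching_rep rT p1.
      rewrite [LHS](_ : _ = false); last first.
        by apply: contraTF vS => /eqP <-; rewrite TS.
      by apply/esym/negbTE; apply: contraNneq r'S => ->.
    by apply: eq_bigr.
  + by apply: crossed => //; rewrite inE vS.
  + have uT : u \in T by rewrite inE uS.
    rewrite xC -(crossed v u) // [LHS]big_mkcond [RHS]big_mkcond.
    apply: eq_bigr => p _.
    have [->|/wP[p1 p2]] := eqVneq (w p.1 p.2) 0; first by rewrite !if_same.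
    have pm := perfect_matching_glue SA rS r'T p1 p2.
    congr (if _ then _ else _); apply/eqP/eqP => <-.
      by have [_ _ ->] := perfect_matchingP pm uA.
    by have [_ _ ->] := perfect_matchingP pm vA.
  + have uT : u \in T by rewrite inE uS.
    have vT : v \in T by rewrite inE vS.
    rewrite -x1T // -m4 ?setU1r //.
    transitivity (\sum_(s1 : {ffun V -> V} | s1 u == v) \sum_s2 w s1 s2).
      rewrite (pair_big (fun s : {ffun V -> V} => s u == v) xpredT) /=.
      rewrite [LHS]big_mkcond [RHS]big_mkcond; apply: eq_bigr => -[s1 s2] _ /=.
      have [->|/wP[p1 p2]] := eqVneq (w s1 s2) 0; first by rewrite !if_same.
      congr (if _ then _ else _); rewrite /glue ffunE (negPf uS) ?andbT.
      have [us|//] := eqVneq u (s1 r).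
      have [_ + _] := perfect_matching_rep rT p1; rewrite -us => ->.
      have [s2S _ _] := perfect_matching_rep r'S p2.
      rewrite [LHS](_ : _ = false); last first.
        by apply: contraNF vS => /eqP <-.
      by apply/esym/negbTE; apply: contraNneq vS => <-.
    by apply: eq_bigr.
Qed.

(** Both sides have at least two nodes, so both contractions are smaller than [A] and the induction
    hypothesis provides the distributions to glue. *)
Lemma matching_hull_tight A S x : 
  (forall A' x', (#|A'| < #|A|)%N -> feasible A' x' -> matching_hull A' x') ->
  feasible A x -> S \subset A -> odd #|S| -> (1 < #|S|)%N ->
  (1 < #|A :\: S|)%N -> cut_weight x A S = 1 -> matching_hull A x.
Proof.
move=> IH fx SA oS S1 T1 cS; have [xC xd x0 xr xo] := fx.
have /card_gt0P[r rS] : (0 < #|S|)%N by apply: ltnW.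
have /card_gt0P[r' r'T] : (0 < #|A :\: S|)%N by apply: ltnW.
have TA : A :\: S \subset A by apply: subsetDl.
have DD : A :\: (A :\: S) = S by rewrite setDDr setDv set0U (setIidPr SA).
have cA : (#|A| = #|S| + #|A :\: S|)%N.
  by rewrite cardsDS // subnKC // subset_leq_card.
have f1 := feasible_contract fx SA rS oS cS.
have f2 : feasible (r' |: S) (contract A (A :\: S) r' x).
  rewrite -[X in _ |: X]DD; apply: feasible_contract => //.
    exact: feasible_setD_odd fx SA oS.
  by rewrite cut_weightC.
apply: (matching_hull_glue fx SA rS r'T _ _ _ _ (IH _ _ _ f1) (IH _ _ _ f2)).
- by move=> a b aT bT; rewrite contract_id.
- by move=> b bT; rewrite contract_rep.
- by move=> a b aS bS; rewrite contract_id // DD.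
- by move=> b bS; rewrite contract_rep // DD.
- rewrite cardsU1 [r \in _]inE rS /=; lia.
- by rewrite cardsU1; case/setDP: r'T => _ /negPf -> /=; lia.
Qed.
End Gluing.

(** * Directions preserving the degrees *)

(** The coefficient matrix has more rows than columns, so its rows are dependent. *)
Lemma linear_system_kernel (R : fieldType) (I J : finType) (P : {set I})
    (W : {set J}) (c : I -> J -> R) : (#|W| < #|P|)%N ->
  exists g : I -> R, [/\ forall i, i \notin P -> g i = 0, exists i, g i != 0
    & forall j, j \in W -> \sum_i g i * c i j = 0].
Proof.
move=> WP.
pose M := \matrix_(a < #|P|, b < #|W|) c (enum_val a) (enum_val b).
have : kermx M != 0.
  rewrite kermx_eq0 /row_free neq_ltn; apply/orP; left.
  exact: leq_ltn_trans (rank_leq_col _) WP.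
case/rowV0Pn => v /sub_kermxP vM v0.
pose g i := \sum_a v 0 a * (enum_val a == i)%:R.
have gE a : g (enum_val a) = v 0 a.
  rewrite /g (bigD1 a) //= eqxx mulr1 big1 ?addr0 // => b ba.
  by rewrite (inj_eq enum_val_inj) (negPf ba) mulr0.
exists g; split.
- move=> i iP; rewrite /g big1 // => a _; case: eqP => [ai|]; last by rewrite mulr0.
  by move: iP; rewrite -ai enum_valP.
- case/rV0Pn: v0 => a va; exists (enum_val a); by rewrite gE.
- move=> j jW; rewrite /g.
  under eq_bigr do rewrite mulr_suml.
  rewrite exchange_big /=; move/rowP/(_ (enum_rank_in jW j)): vM.
  rewrite !mxE => vM; rewrite -[RHS]vM; apply: eq_bigr => a _.
  rewrite mxE enum_rankK_in // (bigD1 (enum_val a)) //= eqxx mulr1.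
  by rewrite big1 ?addr0 // => i /negPf ia; rewrite eq_sym ia mulr0 mul0r.
Qed.

Section Directions.
Variables (R : realFieldType) (V : finType).
Implicit Types (x d : V -> V -> R) (A S T : {set V}).

(** Support within that of [x] allows small moves of either sign without losing nonnegativity; zero
    row sums preserve the degrees. *)
Definition direction A x d : Prop :=
  [/\ forall u v, d u v = d v u,
      forall u v, d u v != 0 -> [/\ u \in A, v \in A & x u v != 0],
      forall u, u \in A -> \sum_(v in A) d u v = 0
    & exists u v, d u v != 0].

Definition fractional x u v := (x u v != 0) && (x u v != 1).

Lemma fractional_neq A x u v : feasible A x -> fractional x u v -> u != v.
Proof.
case=> _ xd _ _ _; apply: contraTneq => <-.
by rewrite /fractional xd eqxx.
Qed.

Lemma fractional_other A x u v : feasible A x -> u \in A -> v \in A ->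
  fractional x u v -> exists a, [/\ a \in A, a != v & fractional x u a].
Proof.
move=> fx uA vA /andP[n0 n1]; have [xC xd x0 _ _] := fx.
have row := feasible_row fx uA.
have : [exists a in A, (a != v) && (x u a != 0)].
  apply: contraT; rewrite negb_exists => /forallP h; move: n1.
  rewrite -row (bigD1 v) //= big1 ?addr0 ?eqxx // => a /andP[aA av].
  by have := h a; rewrite aA av /= negbK => /eqP.
case/exists_inP => a aA /andP[av na]; exists a; split=> //.
rewrite /fractional na /=; apply/eqP => xa1; move: row.
rewrite (bigD1 v) //= (bigD1 a) ?aA //= xa1 => h.
have : 0 <= \sum_(i in A | (i != v) && (i != a)) x u i by exact: sumr_ge0.
have : 0 < x u v by rewrite lt_def n0 x0.
by under eq_bigl do rewrite andbA; move: h => /eqP; lra.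
Qed.

Lemma cut_weight_inside A S x : feasible A x -> S \subset A ->
  cut_weight x A S = #|S|%:R - \sum_(u in S) \sum_(v in S) x u v.
Proof.
move=> fx SA; rewrite -sumr_const -sumrB; apply: eq_bigr => u uS.
rewrite -(feasible_row fx (subsetP SA u uS)) [X in _ = X - _](big_setID S) /=.
by rewrite (setIidPr SA) addrC addrK.
Qed.

(* The direction alternates on the cycle [u, v, b, a] through all of [A]. *)
Lemma direction_four A x u v : feasible A x -> #|A| = 4%N ->
  u \in A -> v \in A -> fractional x u v -> exists d, direction A x d.
Proof.
move=> fx A4 uA vA fuv; have [xC xd x0 _ _] := fx.
have [a [aA av fua]] := fractional_other fx uA vA fuv.
have uv := fractional_neq fx fuv; have ua := fractional_neq fx fua.
have : #|A :\ u :\ v :\ a| == 1%N.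
  apply/eqP; move: A4; rewrite (cardsD1 u) uA (cardsD1 v) !inE vA [v == u]eq_sym uv.
  by rewrite (cardsD1 a) !inE av aA [a == u]eq_sym ua /=; lia.
case/cards1P => b Ab.
have : b \in A :\ u :\ v :\ a by rewrite Ab set11.
rewrite !inE => /and4P[ba bv bu bA].
have sumA (f : V -> R) : \sum_(w in A) f w = f u + (f v + (f a + f b)).
  rewrite (big_setD1 u) //= (big_setD1 v) ?inE ?vA 1?eq_sym ?uv //=.
  rewrite (big_setD1 a) ?inE ?av ?aA 1?[a == u]eq_sym ?ua //=.
  by rewrite Ab big_set1.
have rows w : w \in A -> x w u + (x w v + (x w a + x w b)) = 1.
  by move=> wA; rewrite -sumA (feasible_row fx).
have ru := rows u uA; have rv := rows v vA; have ra := rows a aA.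
have rb := rows b bA; rewrite !xd in ru rv ra rb.
(* On four nodes the row equations force opposite edges to have equal weight, so the whole cycle
   lies in the support. *)
have xab : x a b = x u v.
  by move: ru rv ra rb; rewrite (xC v u) (xC a u) (xC a v) (xC b u) (xC b v) (xC b a); lra.
have xvb : x v b = x u a.
  by move: ru rv ra rb; rewrite (xC v u) (xC a u) (xC a v) (xC b u) (xC b v) (xC b a); lra.
have [xuv _] := andP fuv; have [xua _] := andP fua.
have neqs := (negPf uv, negPf ua, negPf av, negPf ba, negPf bv, negPf bu,
  etrans (eq_sym v u) (negPf uv), etrans (eq_sym a u) (negPf ua),
  etrans (eq_sym v a) (negPf av), etrans (eq_sym a b) (negPf ba),
  etrans (eq_sym v b) (negPf bv), etrans (eq_sym u b) (negPf bu)).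
(* [al] is 1 at [u] and -1 at [b], [be] is 1 at [v] and -1 at [a]. Both sum to 0, so their
   symmetrised product has zero rows and alternates in sign on the cycle. *)
pose al w : R := (w == u)%:R - (w == b)%:R.
pose be w : R := (w == v)%:R - (w == a)%:R.
have alP w : al w != 0 -> w = u \/ w = b.
  have [|wn] := eqVneq w u; first by left.
  have [|wn'] := eqVneq w b; first by right.
  by rewrite /al (negPf wn) (negPf wn') subrr eqxx.
have beP w : be w != 0 -> w = v \/ w = a.
  have [|wn] := eqVneq w v; first by left.
  have [|wn'] := eqVneq w a; first by right.
  by rewrite /be (negPf wn) (negPf wn') subrr eqxx.
have ab p q : al p * be q != 0 -> [/\ p \in A, q \in A & x p q != 0].
  rewrite mulf_eq0 negb_or => /andP[/alP pP /beP qP].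
  case: pP => ->; case: qP => ->; split=> //; last by rewrite xC xab.
  by rewrite xC xvb.
exists (fun p q => al p * be q + be p * al q); split.
- by move=> p q; ring.
- move=> p q; have [h|/ab//] := eqVneq (al p * be q) 0.
  by rewrite h add0r mulrC => /ab[? ?]; rewrite xC.
- move=> w wA; rewrite big_split -!mulr_sumr !sumA /al /be !eqxx !neqs.
  by rewrite /=; ring.
- exists u, v; rewrite /al /be !eqxx !neqs !subr0 mulr1 !mul0r addr0.
  exact: oner_neq0.
Qed.

(** For feasible [x], single nodes and their complements always give tight cuts; the cardinality
    bounds exclude them. *)
Definition tight_free A x := forall S, S \subset A -> odd #|S| ->
  (1 < #|S|)%N -> (1 < #|A :\: S|)%N -> cut_weight x A S != 1.

(* If [u] has only the two fractional neighbours [v] and [a], then [{u, v, a}]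
   is a tight odd cut. *)
Lemma fractional_degree A x u v : feasible A x -> tight_free A x ->
  (4 < #|A|)%N -> u \in A -> v \in A -> fractional x u v ->
  (2 < #|[set w in A | fractional x u w]|)%N.
Proof.
move=> fx tf A4 uA vA fuv; have [xC xd x0 _ xo] := fx.
have [a [aA av fua]] := fractional_other fx uA vA fuv.
have uv := fractional_neq fx fuv; have ua := fractional_neq fx fua.
rewrite ltnNge; apply/negP => N2.
have NE : [set w in A | fractional x u w] = [set v; a].
  apply/esym/eqP; rewrite eqEcard cards2 eq_sym av N2 andbT.
  by apply/subsetP => w; rewrite !inE => /orP[]/eqP->; apply/andP.
have xw w : w \in A -> w != v -> w != a -> x u w = 0.
  move=> wA wv wa; have [//|w0] := eqVneq (x u w) 0.
  have : w \notin [set v; a] by rewrite !inE negb_or wv.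
  rewrite -NE inE wA /fractional w0 /= negbK => /eqP w1.
  have := feasible_row fx uA; rewrite (bigD1 w) //= (bigD1 v) /=; last first.
    by rewrite vA eq_sym.
  have : 0 <= \sum_(i in A | (i != w) && (i != v)) x u i by exact: sumr_ge0.
  have : 0 < x u v by rewrite lt_def x0; case/andP: fuv => ->.
  under [X in _ + (_ + X)]eq_bigl do rewrite -andbA.
  by rewrite w1 => h1 h2 /eqP; move: h1 h2; lra.
pose S := u |: [set v; a].
have uS : u \notin [set v; a] by rewrite !inE negb_or uv.
have cS : #|S| = 3%N by rewrite cardsU1 uS cards2 eq_sym av.
have SA : S \subset A by apply/subsetP => w; rewrite !inE => /or3P[]/eqP->.
have sumS (f : V -> R) : \sum_(w in S) f w = f u + (f v + f a).
  by rewrite big_setU1 //= big_setU1 ?big_set1 // inE eq_sym.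
have ru : x u v + x u a = 1.
  rewrite -(feasible_row fx uA) (big_setID S) /= (setIidPr SA) sumS xd add0r.
  rewrite big1 ?addr0 // => w; rewrite !inE !negb_or => /andP[/and3P[_ wv wa] wA].
  exact: xw.
(* The cut weighs [3 - 2 * (x u v + x u a + x v a)], and the first two terms sum to 1. As the weight
   is at least 1, [x v a] vanishes and the cut is tight. *)
have cutS : cut_weight x A S = 1 - 2 * x v a.
  rewrite cut_weight_inside // !sumS cS !xd (xC v u) (xC a u) (xC a v).
  by move: ru; lra.
have oS : odd #|S| by rewrite cS.
have S1 : (1 < #|A :\: S|)%N by rewrite cardsDS // cS; lia.
have := tf S SA oS _ S1; rewrite cS => /(_ isT) /eqP; apply.
by have := xo S SA oS; have := x0 v a; move: cutS; lra.
Qed.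

(** The handshake count: [f] orders the nodes, so that each fractional edge is represented by one
    ordered pair in [P]. *)
Lemma card_fractional_pairs A x (P : {set V * V}) (f : V -> nat) :
  injective f -> (forall u v, x u v = x v u) -> (forall u, x u u = 0) ->
  P = [set p : V * V | [&& p.1 \in A, p.2 \in A, fractional x p.1 p.2
                        & (f p.1 < f p.2)%N]] ->
  (\sum_(u in A) #|[set w in A | fractional x u w]| = #|P| + #|P|)%N.
Proof.
move=> fI xC xd ->; rewrite -sum1_card [in X in (X + _)%N]big_mkcond.
rewrite [X in (_ + X)%N](reindex_inj (h := fun p => (p.2, p.1))); last first.
  by move=> [a b] [c e] [-> ->].
rewrite /= [X in (_ + X)%N]big_mkcond -big_split /=; set P0 := [set p | _].
transitivity (\sum_u \sum_v (((u, v) \in P0) + ((v, u) \in P0)))%N.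
  rewrite big_mkcond; apply: eq_bigr => u _; case: ifP => uA; last first.
    by rewrite big1 // => v _; rewrite !inE /= uA !andbF.
  rewrite -sum1_card big_mkcond /=; apply: eq_bigr => v _; rewrite !inE /= uA /=.
  rewrite {3}/fractional xC -/(fractional x u v).
  case: (v \in A) => //=; have [fr|//] := boolP (fractional x u v).
  by case: ltngtP => //= /fI uv; move: fr; rewrite uv /fractional xd eqxx.
rewrite pair_bigA; apply: eq_bigr => -[u v] _ /=.
by do 2!case: (_ \in P0).
Qed.

(* All degrees in the graph of fractional edges are at least 3, so that it has
   more edges than nodes. *)
Lemma direction_many A x u v : feasible A x -> tight_free A x ->
  (4 < #|A|)%N -> u \in A -> v \in A -> fractional x u v ->
  exists d, direction A x d.
Proof.
move=> fx tf A4 uA vA fuv; have [xC xd x0 _ _] := fx.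
pose f (w : V) : nat := enum_rank w.
have fI : injective f by move=> a b /ord_inj/enum_rank_inj.
pose P := [set p : V * V | [&& p.1 \in A, p.2 \in A, fractional x p.1 p.2
                        & (f p.1 < f p.2)%N]].
pose N w := [set z in A | fractional x w z].
pose W := [set w in A | N w != set0].
have cP := card_fractional_pairs fI xC xd (erefl P).
have WP : (#|W| < #|P|)%N.
  have W0 : (0 < #|W|)%N.
    apply/card_gt0P; exists u; rewrite inE uA; apply/set0Pn; exists v.
    by rewrite inE vA.
  have : (3 * #|W| <= #|P| + #|P|)%N.
    rewrite -cP mulnC -sum_nat_const [X in (_ <= X)%N](big_setID W) /=.
    apply: leq_trans (leq_addr _ _).
    have -> : A :&: W = W by apply/setIidPr/subsetP => w; rewrite inE => /andP[].
    apply: leq_sum => w; rewrite inE => /andP[wA /set0Pn[z]].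
    rewrite inE => /andP[zA fwz]; exact: fractional_degree fwz.
  lia.
(* One unknown for each fractional edge, one equation for each node that meets such an edge. *)
have [g [gP [p0 gp0] gW]] := linear_system_kernel
  (fun (p : V * V) (w : V) => (p.1 == w)%:R + (p.2 == w)%:R : R) WP.
have sg a b : g (a, b) != 0 -> [/\ a \in A, b \in A, fractional x a b & (f a < f b)%N].
  move=> h; have : (a, b) \in P by apply: contraR h => /gP ->.
  by rewrite inE => /and4P.
pose d a b := g (a, b) + g (b, a).
have sd a b : d a b != 0 -> [/\ a \in A, b \in A & fractional x a b].
  rewrite /d; have [->|/sg[]//] := eqVneq (g (a, b)) 0.
  by rewrite add0r => /sg[? ?]; rewrite /fractional xC.
exists d; split.
- by move=> a b; rewrite /d addrC.
- by move=> a b /sd[? ?] /andP[].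
- move=> w wA; have [wW|wW] := boolP (w \in W); last first.
    rewrite big1 // => z zA; apply/eqP; apply: contraR wW => /sd[_ _ fr].
    by rewrite inE wA; apply/set0Pn; exists z; rewrite inE zA.
  transitivity (\sum_z d w z).
    rewrite [RHS](bigID (mem A)) /= [X in _ + X]big1 ?addr0 // => z zA.
    by apply/eqP; apply: contraR zA => /sd[].
  rewrite -[RHS](gW w wW) /d big_split /=.
  under [RHS]eq_bigr do rewrite mulrDr.
  rewrite big_split /=; congr (_ + _).
    transitivity (\sum_a \sum_b g (a, b) * (a == w)%:R); last first.
      by rewrite pair_bigA; apply: eq_bigr => -[].
    rewrite [RHS](bigD1 w) //=.
    rewrite [X in _ = _ + X]big1 => [|a aw].
      by rewrite addr0; apply: eq_bigr => z _; rewrite eqxx mulr1.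
    by rewrite big1 // => z _; rewrite (negPf aw) mulr0.
  transitivity (\sum_a \sum_b g (a, b) * (b == w)%:R); last first.
    by rewrite pair_bigA; apply: eq_bigr => -[].
  apply: eq_bigr => z _; rewrite [RHS](bigD1 w) //= eqxx mulr1 big1 ?addr0 // => a aw.
  by rewrite (negPf aw) mulr0.
(* [g] lives on pairs of increasing rank, so the reversed pair cannot cancel this entry. *)
- case: p0 gp0 => a b gab; exists a, b; rewrite /d [X in _ + X](_ : _ = 0) ?addr0 //.
  by apply/eqP; apply: contraT => /sg[_ _ _]; have [_ _ _] := sg _ _ gab; lia.
Qed.
End Directions.

(** * The perfect matching polytope *)

(** The ratio test: [t] is the least [sl j / - co j] over the constraints with [co j < 0]. *)
Lemma first_blocking (R : realFieldType) (J : finType) (Q : pred J)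
    (sl co : J -> R) :
  (forall j, Q j -> 0 <= sl j) ->
  (forall j, Q j -> co j < 0 -> 0 < sl j) -> (exists2 j, Q j & co j < 0) ->
  exists t, [/\ 0 < t, forall j, Q j -> 0 <= sl j + t * co j
    & exists j, [/\ Q j, co j < 0 & sl j + t * co j = 0]].
Proof.
move=> sl0 slp [j0 Qj0 cj0].
have P0 : Q j0 && (co j0 < 0) by rewrite Qj0.
case: (@arg_minP _ _ J j0 (fun j => Q j && (co j < 0)) (fun j => sl j / - co j) P0).
move=> j /andP[Qj cj] jmin; have cj' : 0 < - co j by rewrite oppr_gt0.
exists (sl j / - co j); split.
- by rewrite divr_gt0 // slp.
- move=> i Qi; have [ci|ci] := ltP (co i) 0.
    have := jmin i; rewrite Qi ci => /(_ isT).
    by rewrite ler_pdivlMr ?oppr_gt0 // mulrN; lra.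
  by rewrite addr_ge0 ?sl0 // mulr_ge0 // divr_ge0 ?sl0 // ltW.
- by exists j; split=> //; field; rewrite lt_eqF.
Qed.

Section PerfectMatchingPolytope.
Variables (R : realFieldType) (V : finType).
Implicit Types (x d : V -> V -> R) (A S T : {set V}).

Lemma direction_opp A x d :
  direction A x d -> direction A x (fun u v => - d u v).
Proof.
move=> [dC dx d0 [u [v uv]]]; split.
- by move=> a b; rewrite dC.
- by move=> a b; rewrite oppr_eq0; apply: dx.
- by move=> a aA; rewrite sumrN d0 ?oppr0.
- by exists u, v; rewrite oppr_eq0.
Qed.

Lemma direction_neg A x d : direction A x d -> exists u v, d u v < 0.
Proof.
move=> [dC dx d0 [u [v uv]]]; have [uA vA _] := dx u v uv.
have [|duv] := ltP (d u v) 0; first by exists u, v.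
suff /existsP[w dw] : [exists w, d u w < 0] by exists u, w.
apply: contraT; rewrite negb_exists => /forallP h; move: (d0 u uA).
rewrite (bigD1 v) //= => s0.
have : 0 <= \sum_(i in A | i != v) d u i.
  by apply: sumr_ge0 => w _; rewrite leNgt.
by have : 0 < d u v by [rewrite lt_def uv duv]; move: s0 => /eqP; lra.
Qed.

Lemma cut_weight_move A S x d t :
  cut_weight (fun u v => x u v + t * d u v) A S =
  cut_weight x A S + t * cut_weight d A S.
Proof.
rewrite /cut_weight mulr_sumr -big_split; apply: eq_bigr => u _ /=.
by rewrite mulr_sumr -big_split.
Qed.

Lemma direction_diag A x d u : feasible A x -> direction A x d -> d u u = 0.
Proof.
move=> [_ xd _ _ _] [_ dx _ _]; apply/eqP; apply: contraT => /dx[_ _].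
by rewrite xd eqxx.
Qed.

Lemma direction_trivial_cut A S x d : feasible A x -> direction A x d ->
  S \subset A -> odd #|S| -> (#|S| <= 1)%N || (#|A :\: S| <= 1)%N ->
  cut_weight d A S = 0.
Proof.
move=> fx dd SA oS; have [dC dx d0 _] := dd.
have one T : T \subset A -> odd #|T| -> (#|T| <= 1)%N -> cut_weight d A T = 0.
  move=> TA oT T1; have /cards1P[u Tu] : #|T| == 1%N.
    by rewrite eqn_leq T1 /=; case: #|T| oT.
  rewrite Tu cut_weight1 ?(direction_diag _ fx dd) // d0 //.
  by rewrite (subsetP TA) // Tu set11.
case/orP => [/one->//|T1]; rewrite -cut_weightC //.
apply: one => //; first exact: subsetDl.
exact: feasible_setD_odd fx SA oS.
Qed.

Definition edge_support A x :=
  [set p : V * V | [&& p.1 \in A, p.2 \in A & x p.1 p.2 != 0]].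

(** The move stops at the first blocking constraint. A blocking entry leaves the support; a blocking
    odd cut is nontrivial, since trivial ones keep their weight. *)
Lemma feasible_move A x d : feasible A x -> tight_free A x -> direction A x d ->
  exists t : R, [/\ 0 < t, feasible A (fun u v => x u v + t * d u v)
    & (#|edge_support A (fun u v => x u v + t * d u v)%R| < #|edge_support A x|)%N \/
      ~ tight_free A (fun u v => x u v + t * d u v)].
Proof.
move=> fx tf dd; have [xC xd x0 xr xo] := fx; have [dC dx d0 _] := dd.
pose Q (j : V * V + {set V}) := if j is inr T then (T \subset A) && odd #|T| else true.
pose sl (j : V * V + {set V}) :=
  match j with inl p => x p.1 p.2 | inr T => cut_weight x A T - 1 end.
pose co (j : V * V + {set V}) :=
  match j with inl p => d p.1 p.2 | inr T => cut_weight d A T end.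
have [|||t [t0 tQ [j [Qj cj tj]]]] := @first_blocking R _ Q sl co.
- by case=> [p _|S /andP[SA oS]] //=; rewrite subr_ge0 xo.
- case=> [p _|S /andP[SA oS]] /= neg.
    by rewrite lt_def x0 andbT; have [] := dx p.1 p.2 (ltr0_neq0 neg).
  rewrite subr_gt0 lt_def xo // andbT; apply: tf => //.
    by rewrite ltnNge; apply: contraTN neg => h;
      rewrite (direction_trivial_cut fx dd) ?h ?ltxx.
  by rewrite ltnNge; apply: contraTN neg => h;
      rewrite (direction_trivial_cut fx dd) ?h ?orbT ?ltxx.
- by have [u [v uv]] := direction_neg dd; exists (inl (u, v)).
have f' : feasible A (fun u v => x u v + t * d u v).
  split.
  - by move=> u v; rewrite xC dC.
  - by move=> u; rewrite xd (direction_diag _ fx dd) mulr0 addr0.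
  - by move=> u v; apply: (tQ (inl (u, v))).
  - move=> u uA; rewrite cut_weight_move xr // cut_weight1 ?d0 ?mulr0 ?addr0 //.
    exact: direction_diag fx dd.
  - move=> S SA oS; rewrite cut_weight_move; have := tQ (inr S).
    by rewrite /= SA oS => /(_ isT); lra.
exists t; split=> //; case: j Qj cj tj => [[u v] _ /= neg tj|S /andP[SA oS] /= neg tj].
  have [uA vA xuv] := dx u v (ltr0_neq0 neg).
  left; apply: proper_card; apply/properP; split.
    apply/subsetP => -[a b]; rewrite !inE /= => /and3P[-> ->] /=.
    apply: contraNN => /eqP xab; rewrite xab add0r mulf_eq0; apply/orP; right.
    by apply: contraT => /dx[_ _]; rewrite xab eqxx.
  by exists (u, v); rewrite !inE /= uA vA //= tj eqxx.
right=> tf'; suff /eqP : cut_weight (fun u v => x u v + t * d u v) A S = 1.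
  apply/negP; apply: tf' => //; rewrite ltnNge; apply: contraTN neg => h.
    by rewrite (direction_trivial_cut fx dd) ?h ?ltxx.
  by rewrite (direction_trivial_cut fx dd) ?h ?orbT ?ltxx.
by rewrite cut_weight_move; move: tj; lra.
Qed.

Lemma tight_free_dec A x : tight_free A x \/
  exists S, [/\ S \subset A, odd #|S|, (1 < #|S|)%N, (1 < #|A :\: S|)%N
    & cut_weight x A S = 1].
Proof.
case: (boolP [exists S : {set V}, [&& S \subset A, odd #|S|, (1 < #|S|)%N,
                        (1 < #|A :\: S|)%N & cut_weight x A S == 1]]).
  by case/existsP => S /and5P[? ? ? ? /eqP]; right; exists S.
rewrite negb_exists => /forallP h; left=> S SA oS S1 T1.
by have := h S; rewrite SA oS S1 T1.
Qed.

(** The outer induction on [#|A|] serves contraction of a tight cut, the inner one on the size of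
    the support serves moves along a direction. *)
Theorem feasible_matching_hull A x : feasible A x -> matching_hull A x.
Proof.
have [n An] := ubnP #|A|; elim: n A x An => // n IHn A x An.
have [m Am] := ubnP #|edge_support A x|; elim: m x Am => // m IHm x xm fx.
have tight x' : feasible A x' -> ~ tight_free A x' -> matching_hull A x'.
  move=> fx' ntf; case: (tight_free_dec A x') => // -[S [SA oS S1 T1 cS]].
  apply: matching_hull_tight SA oS S1 T1 cS => // A' x'' A'A.
  by apply: IHn; apply: leq_trans A'A _.
case: (tight_free_dec A x) => [tf|[S [SA oS S1 T1 cS]]]; last first.
  by apply: tight => // tf; have := tf S SA oS S1 T1; rewrite cS eqxx.
case: (boolP [exists u in A, exists v in A, fractional x u v]); last first.
  rewrite negb_exists => /forallP h; apply: feasible_integral => // u v uA vA.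
  have := h u; rewrite uA /= negb_exists => /forallP/(_ v).
  by rewrite vA /= negb_and !negbK => /orP[]/eqP; [left|right].
case/exists_inP => u uA /exists_inP[v vA fuv].
have [d dd] : exists d, direction A x d.
  have [A4|] := ltnP 4 #|A|; first exact: direction_many fuv.
  rewrite leq_eqVlt => /orP[/eqP A4|A3]; first exact: direction_four fuv.
  (* With at most three nodes, the distinct [u], [v], [a] fill [A], contradicting its even size. *)
  have [a [aA av fua]] := fractional_other fx uA vA fuv.
  have := feasible_even fx; suff -> : #|A| = 3%N by [].
  apply/eqP; rewrite eqn_leq -ltnS A3 /=.
  suff <- : #|u |: [set v; a]| = 3%N.
    by apply/subset_leq_card/subsetP => w; rewrite !inE => /or3P[]/eqP->.
  by rewrite cardsU1 cards2 !inE negb_or (fractional_neq fx fuv) (fractional_neq fx fua) eq_sym av.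
have dd' := direction_opp dd.
have [t [t0 ft ht]] := feasible_move fx tf dd.
have [s [s0 fs hs]] := feasible_move fx tf dd'.
have mt : matching_hull A (fun u v => x u v + t * d u v).
  by case: ht => [ht|]; [apply: IHm => //; apply: leq_trans ht _|apply: tight].
have ms : matching_hull A (fun u v => x u v + s * - d u v).
  by case: hs => [hs|]; [apply: IHm => //; apply: leq_trans hs _|apply: tight].
have st0 : 0 < s + t by rewrite addr_gt0.
(* Weights [s / (s + t)] on the forward point and [t / (s + t)] on the backward point cancel [d]. *)
have st1 : 0 <= s / (s + t) <= 1.
  apply/andP; split; first by apply: divr_ge0; exact: ltW.
  by rewrite ler_pdivrMr // mul1r lerDl ltW.
apply: matching_hull_ext (matching_hull_convex st1 mt ms) => a b _ _.
by field; rewrite gt_eqF.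
Qed.

End PerfectMatchingPolytope.

(** * The matching polytope *)

(** Counting each edge in both orders turns crossing into a parity test on its ends, so that cuts
    can be compared edge by edge through cases on membership. *)
Lemma cut_weight_addb (R : realFieldType) (V : finType) (x : V -> V -> R)
    (S : {set V}) : (forall u v, x u v = x v u) ->
  2 * cut_weight x [set: V] S =
  \sum_u \sum_v ((u \in S) (+) (v \in S))%:R * x u v.
Proof.
move=> xC; have E : cut_weight x [set: V] S =
    \sum_u \sum_v ((u \in S) && (v \notin S))%:R * x u v.
  rewrite /cut_weight big_mkcond; apply: eq_bigr => u _.
  case: (u \in S); last by rewrite big1 // => v _; rewrite mul0r.
  rewrite big_mkcond; apply: eq_bigr => v _; rewrite !inE andbT /=.
  by case: (v \in S); rewrite /= ?mul1r ?mul0r.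
rewrite mulrDl mul1r {1}E E [X in _ + X]exchange_big -big_split.
apply: eq_bigr => u _; rewrite -big_split; apply: eq_bigr => v _ /=.
rewrite (xC v u) -mulrDl -natrD; congr (_%:R * _).
by case: (u \in S); case: (v \in S).
Qed.

Section Doubling.
Variables (R : realFieldType) (L : finType) (z : L -> L -> R).
Hypothesis zC : forall p q, z p q = z q p.
Hypothesis zd : forall p, z p p = 0.
Hypothesis z0 : forall p q, 0 <= z p q.

(** The probability that [p] stays unmatched when [z] gives the probabilities of the pairs. *)
Definition deficiency p : R := 1 - \sum_q z p q.

Hypothesis tau0 : forall p, 0 <= deficiency p.
Hypothesis oddz : forall W : {set L}, odd #|W| ->
  1 <= cut_weight z [set: L] W + \sum_(p in W) deficiency p.

(* Two copies of the weighted graph [z], with twins joined by their deficiency;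
   a perfect matching of it restricts to a matching of the first copy. *)
Definition doubled (u v : bool * L) : R :=
  if u.1 == v.1 then z u.2 v.2 else if u.2 == v.2 then deficiency u.2 else 0.

Lemma doubledC u v : doubled u v = doubled v u.
Proof.
rewrite /doubled [v.1 == _]eq_sym [v.2 == _]eq_sym zC.
by case: eqP => // _; case: eqP => // ->.
Qed.

Lemma sum_bool_pair (F : bool * L -> R) :
  \sum_u F u = \sum_p (F (true, p) + F (false, p)).
Proof.
transitivity (\sum_b \sum_p F (b, p)).
  by rewrite pair_bigA; apply: eq_bigr => -[].
by rewrite big_bool big_split.
Qed.

Lemma sum_pred1 (p : L) (F : L -> R) : \sum_q (if p == q then F q else 0) = F p.
Proof.
by rewrite -big_mkcond (eq_bigl (pred1 p)) ?big_pred1_eq // => q; rewrite eq_sym.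
Qed.

Lemma doubled_row u : \sum_v doubled u v = 1.
Proof.
case: u => b p; rewrite sum_bool_pair big_split /doubled /=.
by case: b; rewrite /= sum_pred1 /deficiency; ring.
Qed.

Definition layer (U : {set bool * L}) b := [set p | (b, p) \in U].

Definition single_layer U b := layer U b :\: layer U (~~ b).

(** Uncrossing: an edge crosses the two differences of the layers at most as often as the layers
    themselves, and the twin edge of [p] is cut exactly when [p] lies in one difference. *)
Lemma cut_weight_doubled U (W := single_layer U) :
  cut_weight z [set: L] (W true) + \sum_(p in W true) deficiency p +
  (cut_weight z [set: L] (W false) + \sum_(p in W false) deficiency p) <=
  cut_weight doubled [set: bool * L] U.
Proof.
rewrite -(ler_pM2l (_ : 0 < 2 :> R)) ?ltr0n // !mulrDr.
rewrite !cut_weight_addb //; last exact: doubledC.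
rewrite sum_bool_pair.
have twin b p : \sum_q ((((b, p) \in U) (+) ((~~ b, q) \in U))%:R *
    doubled (b, p) (~~ b, q)) = (((b, p) \in U) (+) ((~~ b, p) \in U))%:R * deficiency p.
  rewrite -(sum_pred1 p (fun q => (((b, p) \in U) (+) ((~~ b, q) \in U))%:R * deficiency p)).
  apply: eq_bigr => q _; rewrite /doubled /=; case: b => /=;
  by case: eqP => //; rewrite mulr0.
have rowE b p : \sum_v ((((b, p) \in U) (+) (v \in U))%:R * doubled (b, p) v) =
    \sum_q (((b, p) \in U) (+) ((b, q) \in U))%:R * z p q +
    (((b, p) \in U) (+) ((~~ b, p) \in U))%:R * deficiency p.
  rewrite -twin sum_bool_pair big_split /=.
  by case: b => /=; rewrite 1?addrC; congr (_ + _);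
     apply: eq_bigr => q _; rewrite /doubled.
under [X in _ <= X]eq_bigr do rewrite !rowE /=.
have sumE b : 2 * \sum_(p in W b) deficiency p =
    \sum_p (2 * (p \in W b)%:R) * deficiency p.
  rewrite mulr_sumr big_mkcond; apply: eq_bigr => p _.
  by case: (p \in W b); rewrite ?mulr1 ?mulr0 ?mul0r.
rewrite !sumE -!big_split; apply: ler_sum => p _ /=.
have zpart : \sum_q ((p \in W true) (+) (q \in W true))%:R * z p q +
    \sum_q ((p \in W false) (+) (q \in W false))%:R * z p q <=
    \sum_q (((true, p) \in U) (+) ((true, q) \in U))%:R * z p q +
    \sum_q (((false, p) \in U) (+) ((false, q) \in U))%:R * z p q.
  rewrite -!big_split; apply: ler_sum => q _ /=; rewrite -!mulrDl.
  apply: ler_wpM2r => //; rewrite !inE -!natrD ler_nat.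
  by case: (_ \in U); case: (_ \in U); case: (_ \in U); case: (_ \in U).
have tpart : 2 * (p \in W true)%:R * deficiency p +
    2 * (p \in W false)%:R * deficiency p =
    (((true, p) \in U) (+) ((false, p) \in U))%:R * deficiency p +
    (((false, p) \in U) (+) ((true, p) \in U))%:R * deficiency p.
  rewrite -!mulrDl; congr (_ * _); rewrite !inE.
  by case: (_ \in U); case: (_ \in U); rewrite /=; ring.
by move: zpart tpart; lra.
Qed.

(** Twins lying both in [U] count twice, so for odd [U] one difference of layers is odd; [oddz]
    applies to it, and the other one contributes a nonnegative amount. *)
Lemma doubled_feasible : feasible [set: bool * L] doubled.
Proof.
have d0 u v : 0 <= doubled u v.
  by rewrite /doubled; case: eqP => // _; case: eqP.
split=> //; first exact: doubledC.
- by move=> u; rewrite /doubled eqxx zd.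
- move=> u _; rewrite cut_weight1 ?/doubled ?eqxx ?zd //.
  by rewrite -[RHS](doubled_row u); apply: eq_bigl => v; rewrite inE.
move=> U _ oU; apply: le_trans (cut_weight_doubled U).
have f0 W : 0 <= cut_weight z [set: L] W + \sum_(p in W) deficiency p.
  by rewrite addr_ge0 ?sumr_ge0 // => p _; rewrite sumr_ge0.
have oW : odd #|layer U true :\: layer U false| (+)
          odd #|layer U false :\: layer U true|.
  have cU : #|U| = (#|layer U true| + #|layer U false|)%N.
    rewrite -!sum1_card big_mkcond [X in (X + _)%N]big_mkcond.
    rewrite [X in (_ + X)%N]big_mkcond -big_split /=.
    transitivity (\sum_b \sum_p if (b, p) \in U then 1 else 0)%N.
      by rewrite pair_bigA; apply: eq_bigr => -[].
    rewrite big_bool -big_split; apply: eq_bigr => p _ /=.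
    by rewrite !inE.
  move: oU; rewrite cU -(cardsID (layer U false) (layer U true)).
  rewrite -(cardsID (layer U true) (layer U false)).
  rewrite [layer U false :&: _]setIC !oddD.
  by do 3!case: (odd _).
move: oW; case: (boolP (odd _)) => /= [o1 _|_ o2].
  by have := oddz o1; have := f0 (layer U false :\: layer U true); lra.
by have := oddz o2; have := f0 (layer U true :\: layer U false); lra.
Qed.

(** Perfect matchings of the doubled graph are restricted to the first copy; a fixed point of [s i]
    is a node matched to its twin, that is, left unmatched. *)
Theorem odd_cut_matchings :
  exists (I : finType) (mu : I -> R) (s : I -> L -> L),
    [/\ forall i, 0 <= mu i, \sum_i mu i = 1,
        forall i p, mu i != 0 -> s i (s i p) = p,
        forall i p, mu i != 0 ->
          if s i p == p then deficiency p != 0 else z p (s i p) != 0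
      & forall p q, p != q -> \sum_(i | s i p == q) mu i = z p q].
Proof.
have [mu [mu0 mu1 mup mux]] := feasible_matching_hull doubled_feasible.
pose s (m : {ffun bool * L -> bool * L}) p :=
  if (m (true, p)).1 then (m (true, p)).2 else p.
exists {ffun bool * L -> bool * L}, mu, s; split=> //.
- move=> m p /mup pm; rewrite {2}/s; case mp: (m (true, p)) => [[] q] /=.
    have [_ _] := perfect_matchingP pm (in_setT (true, p)).
    by rewrite mp /s => ->.
  by rewrite /s mp.
- move=> m p mm; have pm := mup m mm.
  have mx u : doubled u (m u) != 0.
    rewrite -mux ?inE // gt_eqF // (bigD1 m) //=.
    by rewrite ltr_pwDl ?sumr_ge0 // lt_def mm mu0.
  have := mx (true, p); have [_ + _] := perfect_matchingP pm (in_setT (true, p)).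
  rewrite /doubled /s; case: (m (true, p)) => [[] q] /=.
    by case: (eqVneq q p) => // -> _; rewrite zd eqxx.
  by rewrite eqxx => _; case: (p == q); rewrite ?eqxx.
- move=> p q pq; have -> : z p q = doubled (true, p) (true, q) by [].
  rewrite -mux ?inE //; apply: eq_bigl => m; rewrite /s.
  case: (m (true, p)) => [[] r] /=; first by rewrite xpair_eqE.
  by rewrite (negPf pq).
Qed.

End Doubling.

(** * The gadget for edge covers *)

Section Tips.
Variables (V E : finType) (G : multigraph V E) (tip : E * bool -> V).
Hypothesis tip_ends :
  forall e, ends G e = [set tip (e, true); tip (e, false)].

Lemma tip_neq e : tip (e, true) != tip (e, false).
Proof. by have := ends_card G e; rewrite tip_ends cards2; case: eqP. Qed.

Lemma in_cut S e :
  (e \in cut G S) = (tip (e, true) \in S) (+) (tip (e, false) \in S).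
Proof.
rewrite inE tip_ends setIUl cardsU.
have -> : [set tip (e, true)] :&: S :&: ([set tip (e, false)] :&: S) = set0.
  apply/setP => u; rewrite !inE; case: eqP => //= ->.
  by rewrite (negPf (tip_neq e)) andbF.
have E1 u : #|[set u] :&: S| = (u \in S).
  have [uS|uS] := boolP (u \in S).
    by rewrite (setIidPl _) ?cards1 // sub1set.
  by apply/eqP; rewrite cards_eq0 setI_eq0 disjoints1.
by rewrite cards0 subn0 !E1; case: (_ \in S); case: (_ \in S).
Qed.

Lemma in_cut1 u e : (e \in cut G [set u]) = (u \in ends G e).
Proof.
rewrite in_cut tip_ends !inE ![u == _]eq_sym.
by case: eqP => // <-; rewrite eq_sym (negPf (tip_neq e)).
Qed.

Lemma degree_cut1 u : degree G [set: E] u = #|cut G [set u]|.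
Proof. by apply: eq_card => e; rewrite in_cut1 !inE. Qed.

Lemma big_pair_bool (T : Type) (idx : T) (op : Monoid.com_law idx)
    (F : E * bool -> T) : \big[op/idx]_d F d =
  \big[op/idx]_e op (F (e, true)) (F (e, false)).
Proof.
transitivity (\big[op/idx]_e \big[op/idx]_b F (e, b)).
  by rewrite pair_bigA; apply: eq_bigr => -[].
by apply: eq_bigr => e _; rewrite big_bool.
Qed.

(** The tips of an edge differ, so each edge at [u] has exactly one dart with tip [u]. *)
Lemma big_cut1 (T : Type) (idx : T) (op : Monoid.com_law idx) (F : E -> T) u :
  \big[op/idx]_(e in cut G [set u]) F e = \big[op/idx]_(d | tip d == u) F d.1.
Proof.
rewrite big_mkcond [RHS]big_mkcond big_pair_bool; apply: eq_bigr => e _ /=.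
rewrite in_cut !inE; case: (tip (e, true) =P u) => [<-|_] /=.
  by rewrite eq_sym (negPf (tip_neq e)) /= Monoid.mulm1.
by case: eqP => _; rewrite Monoid.mul1m.
Qed.

(** An edge contributes the number of its tips in [S], which is odd exactly when it is cut. *)
Lemma sum_degree_parity (S : {set V}) :
  odd (\sum_(u in S) degree G [set: E] u) = odd #|cut G S|.
Proof.
have -> : (\sum_(u in S) degree G [set: E] u =
    \sum_e ((tip (e, true) \in S) + (tip (e, false) \in S)))%N.
  transitivity (\sum_(u in S) \sum_(d | tip d == u) 1)%N.
    by apply: eq_bigr => u _; rewrite degree_cut1 -sum1_card big_cut1.
  transitivity (\sum_(d | tip d \in S) 1)%N.
    rewrite [RHS](partition_big tip (mem S)) //=.
    by apply: eq_bigr => u uS; apply: eq_bigl => d; case: eqP => [->|]; rewrite ?uS ?andbF.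
  by rewrite big_mkcond big_pair_bool; apply: eq_bigr => e _; do 2!case: ifP.
rewrite -sum1_card [in RHS]big_mkcond /=.
elim/big_rec2: _ => // e a b _; rewrite !oddD in_cut => ->.
by case: (_ \in S); case: (_ \in S).
Qed.

End Tips.

Lemma tips_exist (V E : finType) (G : multigraph V E) :
  exists tip : E * bool -> V,
    forall e, ends G e = [set tip (e, true); tip (e, false)].
Proof.
have h e : exists p : V * V, ends G e == [set p.1; p.2].
  have /eqP/cards2P[a [b [_ ->]]] := ends_card G e; by exists (a, b).
exists (fun d => let p := xchoose (h d.1) in if d.2 then p.1 else p.2) => e /=.
exact/eqP/(xchooseP (h e)).
Qed.

(** * The gadget graph and its odd cuts *)

Section Gadget.
Variables (R : realFieldType) (V E : finType) (G : multigraph V E).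
Variables (tip : E * bool -> V) (y : {ffun E -> R^o}) (l : nat).
Hypothesis tip_ends :
  forall e, ends G e = [set tip (e, true); tip (e, false)].
Hypothesis l_lt : forall u, (l < degree G [set: E] u)%N.
Hypothesis y01 : forall e, 0 <= y e <= 1.
Hypothesis y_cut1 : forall u, l%:R <= edge_sum y (cut G [set u]).
Hypothesis y_odd : forall (S : {set V}) (F : {set E}), F \subset cut G S ->
  odd (l * #|S| + #|F|) ->
  1 <= \sum_(u in S) (edge_sum y (cut G [set u]) - l%:R) +
       edge_sum y (cut G S :\: F) + \sum_(e in F) (1 - y e).

Definition excess u := (degree G [set: E] u - l)%N.
Definition slot : finType := {u : V & 'I_(excess u)}.
Definition slot_at u (i : 'I_(excess u)) : slot :=
  Tagged (fun v => 'I_(excess v)) i.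
Definition gadget_node : finType := (E * bool + slot)%type.

(* The node [inl (e, b)] is the dart of [e] towards [tip (e, b)].  The two darts
   of [e] are matched to each other when [e] is in the cover, and each to a slot
   at its tip when [e] is left out. *)
Definition dart_slot (d : E * bool) (c : slot) : R :=
  if tip d == tag c then (1 - y d.1) / (excess (tag c))%:R else 0.

Definition gadget (p q : gadget_node) : R :=
  match p, q with
  | inl d, inl d' => if (d.1 == d'.1) && (d.2 != d'.2) then y d.1 else 0
  | inl d, inr c => dart_slot d c
  | inr c, inl d => dart_slot d c
  | inr _, inr _ => 0
  end.

Lemma gadgetC p q : gadget p q = gadget q p.
Proof.
case: p q => [[e b]|c] [[f b']|c'] //=; rewrite eq_sym [b == _]eq_sym.
by case: eqP => // ->.
Qed.

Lemma gadgetd p : gadget p p = 0.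
Proof. by case: p => [[e b]|c] //=; rewrite !eqxx. Qed.

Lemma excess_gt0 u : 0 < (excess u)%:R :> R.
Proof. by rewrite ltr0n subn_gt0. Qed.

Lemma gadget_ge0 p q : 0 <= gadget p q.
Proof.
have h d c : 0 <= dart_slot d c.
  rewrite /dart_slot; case: eqP => // _; rewrite divr_ge0 ?ler0n // subr_ge0.
  by have /andP[] := y01 d.1.
case: p q => [d|c] [d'|c'] //=; case: ifP => // _.
by have /andP[] := y01 d.1.
Qed.

Lemma big_gadget (T : Type) (idx : T) (op : Monoid.com_law idx)
    (F : gadget_node -> T) :
  \big[op/idx]_p F p =
  op (\big[op/idx]_e op (F (inl (e, true))) (F (inl (e, false))))
     (\big[op/idx]_u \big[op/idx]_(i < excess u) F (inr (slot_at i))).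
Proof.
rewrite big_sumType /= big_pair_bool; congr (op _ _).
rewrite (sig_big_dep xpredT (fun _ => xpredT)
  (fun u i => F (inr (@slot_at u i)))) /=.
by apply: eq_bigr => -[].
Qed.

Lemma sum_dart_slot (H : V -> R) d :
  \sum_u \sum_(i < excess u) H u * dart_slot d (slot_at i) =
  H (tip d) * (1 - y d.1).
Proof.
rewrite (bigD1 (tip d)) //= [X in _ + X]big1 ?addr0 => [|u ud]; last first.
  by rewrite big1 // => i _; rewrite /dart_slot /= eq_sym (negPf ud) mulr0.
rewrite /dart_slot /= eqxx sumr_const card_ord -mulr_natr.
by field; rewrite gt_eqF ?excess_gt0.
Qed.

Lemma sum_dart_dart (H : gadget_node -> R) e b :
  \sum_f (H (inl (f, true)) * gadget (inl (e, b)) (inl (f, true)) +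
          H (inl (f, false)) * gadget (inl (e, b)) (inl (f, false))) =
  H (inl (e, ~~ b)) * y e.
Proof.
rewrite (bigD1 e) //= [X in _ + X]big1 ?addr0 => [|f fe]; last first.
  by rewrite eq_sym (negPf fe) !mulr0 addr0.
by rewrite !eqxx; case: b; rewrite /= mulr0 ?add0r ?addr0.
Qed.

Lemma deficiency_dart d : deficiency gadget (inl d) = 0.
Proof.
case: d => e b; transitivity (1 - \sum_q 1 * gadget (inl (e, b)) q).
  by congr (_ - _); apply: eq_bigr => q _; rewrite mul1r.
rewrite big_gadget [X in _ - (X + _)](sum_dart_dart (fun=> 1)).
by rewrite [X in _ - (_ + X)](sum_dart_slot (fun=> 1) (e, b)) /=; ring.
Qed.

(** The slots at [u] receive [degree - y(delta(u))] in total, shared equally among [degree - l] of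
    them. *)
Lemma deficiency_slot u (i : 'I_(excess u)) :
  deficiency gadget (inr (slot_at i)) =
  (edge_sum y (cut G [set u]) - l%:R) / (excess u)%:R.
Proof.
rewrite /deficiency big_sumType /= [X in _ - (_ + X)]big1 // addr0.
transitivity (1 - \sum_(d | tip d == u) (1 - y d.1) / (excess u)%:R).
  congr (_ - _); rewrite [RHS]big_mkcond; apply: eq_bigr => d _.
  by rewrite /dart_slot.
rewrite -(big_cut1 tip_ends _ (fun e => (1 - y e) / (excess u)%:R)).
rewrite -mulr_suml sumrB sumr_const -(degree_cut1 tip_ends) -/(edge_sum y _).
have -> : degree G [set: E] u = (excess u + l)%N by rewrite subnK // ltnW.
by rewrite natrD; field; rewrite gt_eqF ?excess_gt0.
Qed.

Lemma deficiency_ge0 p : 0 <= deficiency gadget p.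
Proof.
case: p => [d|[u i]]; first by rewrite deficiency_dart.
by rewrite deficiency_slot divr_ge0 ?ler0n // subr_ge0.
Qed.

(** For nodes with equal rows, the edges from [p] out of [W] and from [q] into [W] make up one full
    row, which sums to 1 with the deficiency of [p]. This serves two slots at the same node. *)
Lemma gadget_split_twins (W : {set gadget_node}) (p q : gadget_node) :
  (forall r, gadget p r = gadget q r) -> p \in W -> q \notin W ->
  1 <= cut_weight gadget [set: gadget_node] W +
       \sum_(r in W) deficiency gadget r.
Proof.
move=> pq pW qW.
have row : \sum_(r in ~: W) gadget p r + \sum_(r in W) gadget r q =
    1 - deficiency gadget p.
  rewrite /deficiency subKr [RHS](bigID (mem (~: W))); congr (_ + _).
  by apply: eq_big => [r|r _]; rewrite ?inE ?negbK // pq gadgetC.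
have -> : cut_weight gadget [set: gadget_node] W =
    \sum_(r in ~: W) gadget p r +
    \sum_(r in W :\ p) \sum_(v in ~: W) gadget r v.
  by rewrite /cut_weight setTD (big_setD1 p pW).
have -> : \sum_(r in W) deficiency gadget r =
    deficiency gadget p + \sum_(r in W :\ p) deficiency gadget r.
  by rewrite (big_setD1 p pW).
have Dp : \sum_(r in W :\ p) deficiency gadget r >= 0.
  by apply: sumr_ge0 => r _; apply: deficiency_ge0.
have C2 : \sum_(r in W) gadget r q <=
    \sum_(r in W :\ p) \sum_(v in ~: W) gadget r v.
  rewrite (big_setD1 p) //= (gadgetC p q) -pq gadgetd add0r; apply: ler_sum => r _.
  rewrite (bigD1 q) /=; last by rewrite !inE qW.
  by rewrite lerDl sumr_ge0 // => v _; apply: gadget_ge0.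
by move: row C2 Dp; lra.
Qed.

Lemma gadget_odd (W : {set gadget_node}) : odd #|W| ->
  1 <= cut_weight gadget [set: gadget_node] W +
       \sum_(p in W) deficiency gadget p.
Proof.
move=> oW.
pose i0 u : 'I_(excess u) := Ordinal (etrans (subn_gt0 _ _) (l_lt u)).
case: (boolP [forall u, forall i : 'I_(excess u), (inr (slot_at i) \in W) ==
                                  (inr (slot_at (i0 u)) \in W)]); last first.
  rewrite negb_forall => /existsP[u]; rewrite negb_forall => /existsP[i].
  case: (boolP (inr (slot_at i) \in W)) => iW; case: (boolP (_ \in W)) => jW //= _.
    by apply: gadget_split_twins iW jW; case.
  by apply: gadget_split_twins jW iW; case.
move=> /forallP h; have {h}slotE u (i : 'I_(excess u)) :
    (inr (slot_at i) \in W) = (inr (slot_at (i0 u)) \in W).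
  by have /forallP/(_ i)/eqP := h u.
pose S := [set u | inr (slot_at (i0 u)) \in W].
pose w e b := inl (e, b) \in W; pose a e b := tip (e, b) \in S.
have sW u (i : 'I_(excess u)) : (inr (slot_at i) \in W) = (u \in S) by rewrite slotE inE.
(* The share of [e] in the cut: [y e] if its darts are separated, and [1 - y e] for each dart
   separated from the slots at its tip. *)
pose cost e : R := (w e true (+) w e false)%:R * y e +
  ((w e true (+) a e true)%:R + (w e false (+) a e false)%:R) * (1 - y e).
have rowE e b : \sum_q ((w e b) (+) (q \in W))%:R * gadget (inl (e, b)) q =
    (w e b (+) w e (~~ b))%:R * y e + (w e b (+) a e b)%:R * (1 - y e).
  rewrite big_gadget; congr (_ + _).
    exact: (sum_dart_dart (fun q => (w e b (+) (q \in W))%:R)).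
  rewrite -[RHS](sum_dart_slot (fun u => (w e b (+) (u \in S))%:R) (e, b)).
  by apply: eq_bigr => u _; apply: eq_bigr => i _; rewrite sW.
have slotsE : \sum_u \sum_(i < excess u) \sum_q
      ((inr (slot_at i) \in W) (+) (q \in W))%:R * gadget (inr (slot_at i)) q =
    \sum_d ((inl d \in W) (+) (tip d \in S))%:R * (1 - y d.1).
  transitivity (\sum_u \sum_(i < excess u) \sum_d
      ((inl d \in W) (+) (u \in S))%:R * dart_slot d (slot_at i)).
    apply: eq_bigr => u _; apply: eq_bigr => i _; rewrite big_sumType /=.
    rewrite [X in _ + X]big1 ?addr0 => [|c _]; last by rewrite mulr0.
    by apply: eq_bigr => d _; rewrite sW addbC.
  under eq_bigr do rewrite exchange_big.
  rewrite exchange_big; apply: eq_bigr => d _ /=.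
  exact: (sum_dart_slot (fun u => ((inl d \in W) (+) (u \in S))%:R)).
have cutE : cut_weight gadget [set: gadget_node] W = \sum_e cost e.
  apply: (@mulfI _ 2); first by rewrite pnatr_eq0.
  rewrite cut_weight_addb; last exact: gadgetC.
  rewrite big_gadget slotsE big_pair_bool -big_split mulr_sumr.
  apply: eq_bigr => e _ /=; rewrite !rowE /cost /w /a /=.
  by rewrite [(inl (e, false) \in W) (+) (inl (e, true) \in W)]addbC; ring.
have defE : \sum_(p in W) deficiency gadget p =
    \sum_(u in S) (edge_sum y (cut G [set u]) - l%:R).
  rewrite big_mkcond big_gadget /= big1 ?add0r => [|e _]; last first.
    by rewrite !deficiency_dart !if_same; apply: addr0.
  rewrite [RHS]big_mkcond; apply: eq_bigr => u _.
  under eq_bigr do rewrite sW deficiency_slot.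
  rewrite sumr_const card_ord; case: ifP => _; last by rewrite mul0rn.
  by rewrite -[LHS]mulr_natr divfK // gt_eqF ?excess_gt0.
have cardE : odd #|W| = odd (\sum_e (w e true (+) w e false)) (+)
    odd (\sum_(u in S) excess u).
  rewrite -sum1_card big_mkcond big_gadget oddD; congr (_ (+) _).
    elim/big_rec2: _ => // e m n _; rewrite !oddD => ->.
    by rewrite /w; case: (_ \in W); case: (_ \in W).
  rewrite [in RHS]big_mkcond; congr odd; apply: eq_bigr => u _.
  under eq_bigr do rewrite sW.
  by case: ifP => _; rewrite sum_nat_const card_ord ?muln1 ?muln0.
have cost0 e : 0 <= cost e.
  by have /andP[y0 y1] := y01 e; rewrite /cost;
     case: (w e true); case: (w e false); case: (a e true); case: (a e false);
     rewrite /=; lra.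
have cutS e : (e \in cut G S) = a e true (+) a e false by rewrite (in_cut tip_ends).
rewrite cutE defE.
have def0 : 0 <= \sum_(u in S) (edge_sum y (cut G [set u]) - l%:R).
  by apply: sumr_ge0 => u _; rewrite subr_ge0.
(* A separated edge outside [cut G S] has exactly one dart away from its slots, and costs
   [y e + (1 - y e) = 1] on its own. *)
case: (boolP [exists e, (w e true (+) w e false) && (e \notin cut G S)]).
  case/existsP => e /andP[we]; rewrite cutS => ae.
  rewrite (bigD1 e) //=; have : 1 <= cost e.
    have /andP[y0 y1] := y01 e; move: we ae; rewrite /cost.
    by case: (w e true); case: (w e false); case: (a e true); case: (a e false) => //=; lra.
  have : 0 <= \sum_(f | f != e) cost f by exact: sumr_ge0.
  by move: def0; lra.
rewrite negb_exists => /forallP nobad.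
(* Cut edges with darts on the same side cost [1 - y e]; all other cut edges cost at least [y e]. *)
pose F := [set e in cut G S | ~~ (w e true (+) w e false)].
have FS : F \subset cut G S by apply/subsetP => e; rewrite inE => /andP[].
have DF e : (e \in cut G S :\: F) = w e true (+) w e false.
  have := nobad e; rewrite in_setD [e \in F]in_set.
  by case: (e \in cut G S); case: (w e true (+) w e false).
(* Modulo 2, [#|W|] is [#|cut G S :\: F|] plus the total excess over [S], and the latter is
   [#|cut G S| + l * #|S|]. *)
have oF : odd (l * #|S| + #|F|).
  move: oW; rewrite cardE.
  have -> : (\sum_e (w e true (+) w e false) = #|cut G S :\: F|)%N.
    rewrite -sum1_card [RHS]big_mkcond; apply: eq_bigr => e _.
    by rewrite DF; case: (_ (+) _).
  have : odd (\sum_(u in S) excess u + l * #|S|) = odd #|cut G S|.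
    rewrite -(sum_degree_parity tip_ends) mulnC -sum_nat_const -big_split.
    by congr odd; apply: eq_bigr => u _; rewrite /= subnK // ltnW.
  rewrite -(cardsID F (cut G S)) (setIidPr FS) !oddD.
  by do 4!case: (odd _).
apply: le_trans (y_odd FS oF) _; rewrite -addrA addrC lerD2r.
rewrite /edge_sum big_mkcond [X in _ + X]big_mkcond -big_split.
apply: ler_sum => e _; rewrite DF [e \in F]in_set cutS /=.
have /andP[y0 y1] := y01 e; rewrite /cost.
have := nobad e; rewrite cutS.
by case: (w e true); case: (w e false); case: (a e true); case: (a e false) => //=; lra.
Qed.

End Gadget.

(** * The edge cover polytope *)

(** [convex_hull] wants every listed point in [A], so points of weight 0 are replaced by one of
    nonzero weight. *)
Lemma convex_hull_family (R : numDomainType) (W : lmodType R) (A : W -> Prop)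
    (I : finType) (mu : I -> R) (p : I -> W) :
  (forall i, 0 <= mu i) -> \sum_i mu i = 1 ->
  (forall i, mu i != 0 -> A (p i)) -> convex_hull A (\sum_i mu i *: p i).
Proof.
move=> mu0 mu1 Ap.
have /existsP[i0 mi0] : [exists i, mu i != 0].
  apply: contraT; rewrite negb_exists => /forallP h; move: mu1.
  rewrite big1 => [/esym/eqP|i _]; first by rewrite oner_eq0.
  by apply/eqP; rewrite -[_ == _]negbK h.
pose q i := if mu i == 0 then p i0 else p i.
exists #|{: I}|, (fun j => mu (enum_val j)), (fun j => q (enum_val j)); split.
- by move=> j; rewrite /q; case: eqP => [_|/eqP]; apply: Ap.
- by move=> j; apply: mu0.
- by rewrite -mu1 -(big_enum_val mu); apply: eq_bigl.
- rewrite -(big_enum_val (fun i => mu i *: q i)); apply: eq_big => // i _.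
  by rewrite /q; case: eqP => // ->; rewrite !scale0r.
Qed.

Section CoverPolytope.
Variables (R : realFieldType) (V E : finType) (G : multigraph V E).

(** Darts have deficiency 0, so an edge at [u] outside the set has its dart at [u] matched to a slot
    there. Distinct edges use distinct slots, hence at most [excess G l u] edges at [u] are left
    out. *)
Lemma gadget_cover (tip : E * bool -> V) (y : {ffun E -> R^o}) (l : nat)
    (s : gadget_node G l -> gadget_node G l) :
  (forall e, ends G e = [set tip (e, true); tip (e, false)]) ->
  (forall u, (l < degree G [set: E] u)%N) ->
  (forall p, s (s p) = p) ->
  (forall p, if s p == p then deficiency (@gadget R V E G tip y l) p != 0
             else @gadget R V E G tip y l p (s p) != 0) ->
  edge_cover G l [set e | s (inl (e, true)) == inl (e, false)].
Proof.
move=> tip_ends l_lt sK sP u; set C := [set e | _].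
pose N := [set e | (u \in ends G e) && (e \notin C)].
have degE : degree G [set: E] u = (degree G C u + #|N|)%N.
  rewrite /degree -(cardsID C [set e in [set: E] | u \in ends G e]).
  by congr (_ + _)%N; apply: eq_card => e; rewrite !inE /= andbC.
suff : (#|N| <= excess G l u)%N.
  by have := l_lt u; rewrite /excess degE; lia.
pose d e : E * bool := (e, tip (e, true) == u).
pose f e := s (inl (d e)).
have fI : injective f.
  by move=> e e' /(can_inj sK) [].
rewrite -(card_imset _ fI) -[X in (_ <= X)%N](card_ord (excess G l u)).
pose g (i : 'I_(excess G l u)) : gadget_node G l := inr (slot_at i).
apply: leq_trans (leq_imset_card g xpredT); apply/subset_leq_card.
apply/subsetP => _ /imsetP[e eN ->]; move: eN; rewrite inE => /andP[ue eC].
have tipd : tip (d e) = u.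
  move: ue; rewrite tip_ends !inE /d; case: (eqVneq (tip (e, true)) u) => //.
  by move=> _ /eqP ->.
have := sP (inl (d e)); rewrite -/(f e) deficiency_dart // eqxx.
case: ifP => // _; case fe: (f e) => [[e' b]|c] /=.
  case: ifP => [/andP[/eqP ee' bb]|]; last by rewrite eqxx.
  case/negP: eC; rewrite inE; move: fe bb; rewrite /f /d -ee' /=.
  case: (tip (e, true) == u); case: b => // fe _; first by rewrite fe.
  by rewrite -fe sK.
rewrite /dart_slot tipd; case: (u =P tag c) => [uc _|_]; last by rewrite eqxx.
case: c fe uc => v i /= _ uv; move: i; rewrite -uv => i.
by apply/imsetP; exists i.
Qed.

(** The marginal of the two darts of [e] is [y e], so the covers read off the matchings average to
    [y]. *)
Theorem cov_polytope_odd_cuts (y : {ffun E -> R^o}) (l : nat) :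
  (forall u, (l < degree G [set: E] u)%N) ->
  (forall e, 0 <= y e <= 1) ->
  (forall u, l%:R <= edge_sum y (cut G [set u])) ->
  (forall (S : {set V}) (F : {set E}), F \subset cut G S ->
     odd (l * #|S| + #|F|) ->
     1 <= \sum_(u in S) (edge_sum y (cut G [set u]) - l%:R) +
          edge_sum y (cut G S :\: F) + \sum_(e in F) (1 - y e)) ->
  cov_polytope G l y.
Proof.
move=> l_lt y01 y_cut1 y_odd; have [tip tip_ends] := tips_exist G.
have [I [mu [s [mu0 mu1 sK sP sz]]]] := odd_cut_matchings
  (@gadgetC R V E G tip y l) (@gadgetd R V E G tip y l)
  (gadget_ge0 (G := G) (l := l) tip y01)
  (deficiency_ge0 tip_ends l_lt y_cut1)
  (gadget_odd tip_ends l_lt y01 y_cut1 y_odd).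
pose C i := [set e | s i (inl (e, true)) == inl (e, false)].
have -> : y = \sum_i mu i *: char_vec R (C i).
  apply/ffunP => e; rewrite sum_ffunE.
  have neq : inl (e, true) != inl (e, false) :> gadget_node G l by apply/eqP => -[].
  have := sz _ _ neq.
  rewrite /= eqxx /= => <-; rewrite big_mkcond; apply: eq_bigr => i _.
  rewrite !ffunE inE; case: (s i _ == _); last by rewrite scaler0.
  by rewrite /GRing.scale /= mulr1.
apply: convex_hull_family => // i mi; exists (C i) => //.
by apply: (gadget_cover tip_ends l_lt) => p; [apply: sK|apply: sP].
Qed.

(** * Scaling points of the connectivity polytope *)

Lemma sum_cut1 (x : {ffun E -> R^o}) :
  \sum_u edge_sum x (cut G [set u]) = 2 * edge_sum x [set: E].
Proof.
have [tip tip_ends] := tips_exist G.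
transitivity (\sum_u \sum_(d : E * bool | tip d == u) x d.1).
  by apply: eq_bigr => u _; rewrite /edge_sum (big_cut1 tip_ends).
transitivity (\sum_(d : E * bool) x d.1).
  by rewrite [RHS](partition_big tip xpredT).
rewrite big_pair_bool /edge_sum mulr_sumr; apply: eq_big => [e|e _].
  by rewrite inE.
by rewrite /=; ring.
Qed.

Lemma con_polytope_cut1 (k : nat) (x : {ffun E -> R^o}) u :
  #|V| <> 1%N -> con_polytope G k x -> k%:R <= edge_sum x (cut G [set u]).
Proof.
move=> V1 [xk _]; apply: xk; first by apply/set0Pn; exists u; rewrite set11.
rewrite properE subsetT /=; apply/negP => /subset_leq_card.
rewrite cardsT cards1; have : (0 < #|V|)%N by apply/card_gt0P; exists u.
by case: #|V| V1 => [|[|]].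
Qed.

Lemma edge_sumZ (c : R) (x : {ffun E -> R^o}) (F : {set E}) :
  edge_sum (c *: x) F = c * edge_sum x F.
Proof.
by rewrite /edge_sum mulr_sumr; apply: eq_bigr => e _; rewrite ffunE.
Qed.

Lemma scaled_con_cov (k l : nat) (c : R) (x : {ffun E -> R^o}) :
  #|V| <> 1%N -> (0 < l < k)%N -> con_polytope G k x ->
  l%:R <= c * k%:R -> c <= 1 ->
  ~~ odd (l * #|V|) \/
    l%:R * #|V|%:R + 1 <= 2 * (c * edge_sum x [set: E]) ->
  cov_polytope G l (c *: x).
Proof.
move=> V1 /andP[l0 lk] hx ck c1 par; have [xk x01] := hx.
have l1 : 1 <= l%:R :> R by rewrite ler1n.
have kl : l%:R + 1 <= k%:R :> R by rewrite natr1 ler_nat.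
have c0 : 0 <= c.
  by rewrite leNgt; apply/negP => cn; have : c * k%:R <= 0; [rewrite nmulr_rle0|]; lra.
have xge0 e : 0 <= x e by case/andP: (x01 e).
have xle1 e : x e <= 1 by case/andP: (x01 e).
have k1 u : k%:R <= edge_sum x (cut G [set u]).
  exact: con_polytope_cut1 V1 hx.
have slack u : c * k%:R - l%:R <=
    edge_sum (c *: x) (cut G [set u]) - l%:R.
  by rewrite edge_sumZ lerD2r ler_wpM2l.
have cx e : 0 <= (c *: x) e <= 1.
  by rewrite ffunE mulr_ge0 //= mulr_ile1.
apply: cov_polytope_odd_cuts => //.
- move=> u; apply: leq_trans lk _; rewrite -(ler_nat R).
  apply: le_trans (k1 u) _; have [tip tip_ends] := tips_exist G.
  rewrite (degree_cut1 tip_ends) -sum1_card natr_sum.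
  exact: ler_sum.
- by move=> u; rewrite -subr_ge0; apply: le_trans (slack u); rewrite subr_ge0.
move=> S F FS oF.
have [S0|S0] := eqVneq S set0.
  move: FS oF; have -> : cut G S = set0.
    by apply/setP => e; rewrite !inE S0 setI0 cards0.
  by rewrite subset0 => /eqP ->; rewrite S0 !cards0 muln0.
have [ST|ST] := eqVneq S [set: V].
  have C0 : cut G S = set0.
    by apply/setP => e; rewrite !inE ST setIT ends_card.
  have F0 : F = set0 by apply/eqP; rewrite -subset0 -C0.
  move: oF; rewrite C0 F0 set0D /edge_sum !big_set0 !addr0 cards0 addn0 ST cardsT.
  move=> oV; case: par => [|par]; first by rewrite oV.
  rewrite -/(edge_sum _ _) sumrB sumr_const cardsT.
  under eq_bigl do rewrite inE.
  by rewrite sum_cut1 edge_sumZ -mulr_natr; lra.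
have kS := xk S S0; rewrite properT ST in kS.
have {}kS := kS isT; rewrite /edge_sum (big_setID F) /= (setIidPr FS) in kS.
have sumS : c * k%:R - l%:R <=
    \sum_(u in S) (edge_sum (c *: x) (cut G [set u]) - l%:R).
  case/set0Pn: S0 => u uS; rewrite (bigD1 u) //=; apply: le_trans (slack u) _.
  rewrite lerDl sumr_ge0 // => v _; apply: le_trans (slack v).
  by rewrite subr_ge0.
rewrite edge_sumZ [X in _ + X]sumrB sumr_const.
have -> : \sum_(e in F) (c *: x) e = c * \sum_(e in F) x e.
  by rewrite -edge_sumZ.
have xF : \sum_(e in F) x e <= #|F|%:R.
  by rewrite -sum1_card natr_sum; apply: ler_sum.
have xF0 : 0 <= \sum_(e in F) x e by apply: sumr_ge0.
have xD0 : 0 <= \sum_(e in cut G S :\: F) x e by apply: sumr_ge0.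
move: kS sumS xF xF0 xD0; rewrite /edge_sum.
set a := \sum_(e in F) x e; set b := \sum_(e in _) x e; set t := \sum_(u in S) _.
move=> kS sumS xF a0 b0.
(* If [a >= k], then [#|F| - c * a >= (1 - c) * k], and adding [c * k - l] gives [k - l >= 1]. *)
have [ka|ak] := leP k%:R a.
  have : (1 - c) * k%:R <= (1 - c) * a by rewrite ler_wpM2l // subr_ge0.
  have : 0 <= c * b by exact: mulr_ge0.
  by move: sumS xF; rewrite -/(#|F|%:R : R); lra.
have cab : c * (k%:R - a) <= c * b by rewrite ler_wpM2l //; lra.
have k0 : 0 < k%:R :> R by lra.
(* The remaining bound is affine in [a]: it interpolates between [2 * c * k - l - 1] at [a = 0] and
   [k - l - 1] at [a = k], both nonnegative. *)
have : 0 <= k%:R * (2 * (c * k%:R) - l%:R - 1 + a - 2 * (c * a)).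
  have -> : k%:R * (2 * (c * k%:R) - l%:R - 1 + a - 2 * (c * a)) =
    (k%:R - a) * (2 * (c * k%:R) - l%:R - 1) + a * (k%:R - l%:R - 1) by ring.
  by rewrite addr_ge0 // mulr_ge0 //; lra.
rewrite pmulr_rge0 // => convex.
by move: sumS xF cab; lra.
Qed.

End CoverPolytope.

(** A single node is excluded by [hV]: the cut conditions are then vacuous, while without loops
    there is no edge to cover it. *)
Theorem theorem1 (R : realFieldType) (V E : finType) (G : multigraph V E)
    (k l : nat) (x : {ffun E -> R^o})
    (hV : #|V| <> 1%N) (hl1 : (1 <= l)%N) (hlk : (l <= k - 1)%N)
    (hx : con_polytope G k x) :
  let xE := edge_sum x [set: E] in
  let n : R := #|V|%:R in
  let good := ~~ odd (l * #|V|)%N \/ k%:R * n / 2 + k%:R / (2 * l%:R) <= xE in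
  (good -> cov_polytope G l ((l%:R / k%:R) *: x)) /\
  (~ good ->
     cov_polytope G l (((l%:R * n + 1) / (2 * xE)) *: x) /\
     cov_polytope G l ((l%:R / k%:R + 1 / (k%:R * n)) *: x)).
Proof.
move=> xE n good.
have lk : (0 < l < k)%N by lia.
have l1 : 1 <= l%:R :> R by rewrite ler1n.
have kl : l%:R + 1 <= k%:R :> R by rewrite natr1 ler_nat; lia.
have k0 : 0 < k%:R :> R by lra.
split=> [hgood|bad].
  apply: scaled_con_cov hx _ _ _ => //.
  - by rewrite divfK ?gt_eqF.
  - by rewrite ler_pdivrMr // mul1r; lra.
  case: hgood => [|h]; [by left|right; rewrite -/xE -/n].
  (* The factor [2 * l / k] turns the threshold on [xE] into [l * n + 1]. *)
  have -> : 2 * (l%:R / k%:R * xE) = (2 * l%:R / k%:R) * xE by ring.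
  have -> : l%:R * n + 1 = (2 * l%:R / k%:R) * (k%:R * n / 2 + k%:R / (2 * l%:R)).
    by field; rewrite !gt_eqF //; lra.
  by rewrite ler_wpM2l // divr_ge0 //; lra.
have oV : odd (l * #|V|) by apply: contraT => h; case: bad; left.
have n1 : 1 <= n.
  by rewrite ler1n; move: oV; rewrite oddM => /andP[_]; case: #|V|.
have xE_lt : xE < k%:R * n / 2 + k%:R / (2 * l%:R).
  by rewrite ltNge; apply/negP => h; case: bad; right.
have knx : k%:R * n <= 2 * xE.
  rewrite -(sum_cut1 G) /n mulr_natr -[X in X <= _]sumr_const.
  by apply: ler_sum => u _; apply: con_polytope_cut1.
(* This keeps both scalars at most 1, with [knx] for the one whose denominator is [2 * xE]. *)
have kn0 : k%:R * n >= l%:R * n + 1.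
  have : (k%:R - l%:R - 1) * n >= 0 by rewrite mulr_ge0 //; lra.
  by rewrite !mulrBl mul1r; lra.
have x0 : 0 < 2 * xE.
  by apply: lt_le_trans knx; rewrite mulr_gt0 //; lra.
have c3E : l%:R / k%:R + 1 / (k%:R * n) = (l%:R * n + 1) / (k%:R * n).
  by field; rewrite !gt_eqF //; lra.
have kn_gt0 : 0 < k%:R * n by rewrite mulr_gt0 //; lra.
split; apply: scaled_con_cov hx _ _ _ => //.
(* The bound [l <= c * k] is the failure of the threshold, multiplied by [2 * l]. *)
- rewrite mulrAC ler_pdivlMr //.
  have -> : (l%:R * n + 1) * k%:R =
      2 * l%:R * (k%:R * n / 2 + k%:R / (2 * l%:R)).
    by field; rewrite gt_eqF //; lra.
  have -> : l%:R * (2 * xE) = 2 * l%:R * xE by ring.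
  by apply: ler_wpM2l; [lra|exact: ltW].
- by rewrite ler_pdivrMr // mul1r; lra.
- right; rewrite -/xE -/n le_eqVlt; apply/orP; left; apply/eqP.
  by field; rewrite gt_eqF //; lra.
- rewrite mulrDl divfK ?gt_eqF // lerDl mulr_ge0 ?ltW //.
  by rewrite divr_gt0.
- by rewrite c3E ler_pdivrMr // mul1r.
(* As [k * n <= 2 * xE], the scaled total is still at least [l * n + 1]. *)
- right; rewrite -/xE -/n c3E [2 * _]mulrCA mulrAC ler_pdivlMr //.
  by apply: ler_wpM2l => //; apply: addr_ge0 => //; apply: mulr_ge0; lra.
Qed.
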